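(* Let $\mathcal R=(\mathbb R,<,+,\dots)$ be an expansion of the ordered additive group of real numbers which is type A, and let $k\in\mathbb N$. Let $Z\subseteq\mathbb R^n$ be definable, let $(I_z)_{z\in Z}$ be a definable family of bounded open intervals, and let $(f_z:I_z\to\mathbb R)_{z\in Z}$ be a definable family of continuous functions. Then there is a definable family $(U_z)_{z\in Z}$ such that, for every $z\in Z$, $U_z$ is an open dense subset of $I_z$ and $f_z$ is $C^k$ on $U_z$.
   Context: ''Definable'' means definable in $\mathcal R$ with parameters. A set is $\omega$-orderable if it is definable and either finite or admits a definable ordering of order type $\omega$; it is dense if dense in some nonempty open interval. $\mathcal R$ is type A if it does not define a dense $\omega$-orderable set. *)

(* Defs.v *)
From HB Require Import structures.
From mathcomp Require Import all_boot all_order all_algebra.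
From mathcomp Require Import all_classical all_reals all_analysis.

Set Implicit Arguments.
Unset Strict Implicit.
Unset Printing Implicit Defensive.

Import Order.TTheory GRing.Theory Num.Theory.
Import numFieldNormedType.Exports.

Local Open Scope classical_set_scope.
Local Open Scope ring_scope.

(* Symbols are indexed by their arity. *)
Record language := Language {
  fsymb : nat -> Type;
  rsymb : nat -> Type
}.

Record structure (L : language) (M : Type) := Structure {
  fun_interp : forall n, fsymb L n -> ('I_n -> M) -> M;
  rel_interp : forall n, rsymb L n -> ('I_n -> M) -> Prop
}.

(* Variables are de Bruijn indices. *)
Inductive term (L : language) : Type :=
| TVar of nat
| TApp n of fsymb L n & ('I_n -> term L).

Inductive formula (L : language) : Type :=
| FEq of term L & term L
| FRel n of rsymb L n & ('I_n -> term L)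
| FNot of formula L
| FAnd of formula L & formula L
| FEx of formula L.

Fixpoint eval (L : language) (M : Type) (S : structure L M) (e : nat -> M)
    (t : term L) : M :=
  match t with
  | TVar i => e i
  | TApp _ f args => fun_interp S f (fun i => eval S e (args i))
  end.

Definition scons (M : Type) (a : M) (e : nat -> M) : nat -> M :=
  fun i => if i is j.+1 then e j else a.

Fixpoint sat (L : language) (M : Type) (S : structure L M) (e : nat -> M)
    (phi : formula L) : Prop :=
  match phi with
  | FEq s t => eval S e s = eval S e t
  | FRel _ r args => rel_interp S r (fun i => eval S e (args i))
  | FNot phi => ~ sat S e phi
  | FAnd phi psi => sat S e phi /\ sat S e psi
  | FEx phi => exists a, sat S (scons a e) phi
  end.

Section Definability.
Context (R : realType) (L : language) (S : structure L R).

Definition expands_ordered_group : Prop :=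
  (exists r : rsymb L 2, forall v : 'I_2 -> R,
     rel_interp S r v <-> v ord0 < v ord_max) /\
  (exists f : fsymb L 2, forall v : 'I_2 -> R,
     fun_interp S f v = v ord0 + v ord_max).

(* Variables 0, ..., n-1 read the vector, the others read the parameters. *)
Definition point_env n (v : 'rV[R]_n) (p : nat -> R) : nat -> R :=
  fun i => if insub i is Some j then v ord0 (j : 'I_n) else p (i - n)%N.

(* A formula mentions finitely many variables, so only finitely many of the
   parameters p are used. *)
Definition definable n (X : set 'rV[R]_n) : Prop :=
  exists (phi : formula L) (p : nat -> R),
    forall v, X v <-> sat S (point_env v p) phi.

Definition definable_family n (Z : set 'rV[R]_n) m
    (A : 'rV[R]_n -> set 'rV[R]_m) : Prop :=
  definable [set v : 'rV[R]_(n + m) | Z (lsubmx v) /\ A (lsubmx v) (rsubmx v)].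

Definition vec_set (A : set R) : set 'rV[R]_1 := [set v | A (v ord0 ord0)].

Definition graph_on (D : set R) (f : R -> R) : set 'rV[R]_2 :=
  [set v | D (v ord0 ord0) /\ v ord0 ord_max = f (v ord0 ord0)].

(* prec is a strict ordering of X, and g is an isomorphism from (nat, <) onto
   (X, prec). *)
Definition omega_orderable n (X : set 'rV[R]_n) : Prop :=
  definable X /\
  (finite_set X \/
   exists prec : 'rV[R]_n -> 'rV[R]_n -> Prop,
     definable [set v : 'rV[R]_(n + n) |
       [/\ X (lsubmx v), X (rsubmx v) & prec (lsubmx v) (rsubmx v)]] /\
     exists g : nat -> 'rV[R]_n,
       set_bij [set: nat] X g /\
       forall i j : nat, (i < j)%N <-> prec (g i) (g j)).

Definition dense_in (X I : set R) : Prop := I `<=` closure (X `&` I).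

Definition somewhere_dense (X : set R) : Prop :=
  exists I : set R, [/\ I !=set0, open I, is_interval I & dense_in X I].

Definition type_A : Prop :=
  ~ exists X : set R, omega_orderable (vec_set X) /\ somewhere_dense X.

End Definability.

Section Smoothness.
Context (R : realType).

Definition bounded_open_interval (I : set R) : Prop :=
  [/\ open I, is_interval I & bounded_set I].

(* Meant for open U: the derivatives at points of U then depend only on the
   values of f on U. *)
Definition Ck_on (k : nat) (f : R -> R) (U : set R) : Prop :=
  (forall j x, (j < k)%N -> U x -> derivable (derive1n j f) x 1) /\
  (forall j, (j <= k)%N -> {within U, continuous (derive1n j f)}).

End Smoothness.

(* Main.v *)
(* Differences of f replace its derivatives, which are not definable. Call F
   m-convex on an interval if all its m-fold differences there are nonnegative;
   a continuous function that is, up to sign, j-convex for all 2 <= j <= k + 2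
   is C^k. So it suffices to show that a definable continuous F is m-convex up
   to sign on some subinterval of any given interval, by induction on m.

   For the step, compare points by Q x y: F (_ + t) - F is m-convex near x for
   all t near y - x. Where the m-th derivative exists, this compares its values
   near x and near y. Q is definable, open and transitive, and the induction
   hypothesis with the Baire category theorem makes Q-comparable pairs dense.
   Either Q x x for some x, which gives the claim at once, or Q is irreflexive,
   and type A yields an interval on which Q is [<] or [>]: gluing then gives
   (m+1)-convexity of F or of - F.

   Type A enters as a definable Baire principle: an increasing definable family
   of nowhere dense sets has a nowhere dense union. For families of finite sets
   the union is omega-orderable. In general, either all sets are finite on a
   given interval, or the gap lengths of an infinite one form a definable
   sequence converging to 0, and large gaps along it give finite sets again. *)

Require Import Defs.
From HB Require Import structures.
From mathcomp Require Import all_boot all_order all_algebra.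
From mathcomp Require Import all_classical all_reals all_analysis.
From mathcomp Require Import lra zify.
Set Implicit Arguments.
Unset Strict Implicit.
Unset Printing Implicit Defensive.
Import Order.TTheory GRing.Theory Num.Theory.
Import numFieldNormedType.Exports.
Local Open Scope classical_set_scope.
Local Open Scope ring_scope.

(** * Closure properties of definable predicates and functions *)

Section DefinablePredicates.
Context (R : realType) (L : language) (S : structure L R).
Local Notation env := (nat -> R).

Fixpoint trename (r : nat -> nat) (t : term L) : term L :=
  match t with
  | TVar i => TVar L (r i)
  | TApp _ f args => TApp f (fun i => trename r (args i))
  end.

Definition up (r : nat -> nat) (i : nat) : nat := if i is j.+1 then (r j).+1 else 0.

Fixpoint frename (r : nat -> nat) (phi : formula L) : formula L :=
  match phi with
  | FEq s t => FEq (trename r s) (trename r t)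
  | FRel _ p args => FRel p (fun i => trename r (args i))
  | FNot phi => FNot (frename r phi)
  | FAnd phi psi => FAnd (frename r phi) (frename r psi)
  | FEx phi => FEx (frename (up r) phi)
  end.

Lemma eval_trename (e : env) r t : Defs.eval S e (trename r t) = Defs.eval S (e \o r) t.
Proof.
by elim: t => //= n f args IH; congr fun_interp; apply/funext => i; exact: IH.
Qed.

Lemma sat_frename (e : env) r phi : sat S e (frename r phi) <-> sat S (e \o r) phi.
Proof.
elim: phi e r => [s t|n p args|phi IH|phi IH psi IH'|phi IH] e r /=.
- by rewrite !eval_trename.
- rewrite (_ : (fun i => _) = (fun i => Defs.eval S (e \o r) (args i))) //.
  by apply/funext => i; rewrite eval_trename.
- by rewrite IH.
- by rewrite IH IH'.
- suff scons_up a : scons a e \o up r = scons a (e \o r).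
    by split=> -[a]; [rewrite IH|rewrite -scons_up -IH]; rewrite ?scons_up; exists a.
  by apply/funext => -[].
Qed.

(* Interleaves the free variables (even indices) with the parameters (odd
   indices), so that no bound on the number of free variables is needed. *)
Definition mix (e p : env) : env := fun i => if odd i then p i./2 else e i./2.

(** Predicates on infinite environments replace sets of row vectors, so that no arities have to be
    tracked; [definable_dfn] and [dfn_definable] translate between the two. *)
Definition dfn (P : env -> Prop) : Prop :=
  exists phi p, forall e, P e <-> sat S (mix e p) phi.

Definition dfun (t : env -> R) : Prop :=
  dfn (fun e => e 0%N = t (fun i => e i.+1)).

Lemma eq_dfn (P Q : env -> Prop) : (forall e, P e <-> Q e) -> dfn P -> dfn Q.
Proof. by move=> PQ [phi [p Pphi]]; exists phi, p => e; rewrite -PQ. Qed.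

Lemma dfn_rename (P : env -> Prop) (r : nat -> nat) :
  dfn P -> dfn (fun e => P (fun i => e (r i))).
Proof.
move=> [phi [p Pphi]].
exists (frename (fun i => if odd i then i else (r i./2).*2) phi), p => e.
rewrite sat_frename Pphi; set x := mix _ _; set y := _ \o _.
suff -> : x = y by [].
by apply/funext => i; rewrite /x /y /mix /=; case: (boolP (odd i)) => io;
  rewrite ?io // odd_double doubleK.
Qed.

Lemma dfn_not (P : env -> Prop) : dfn P -> dfn (fun e => ~ P e).
Proof. by move=> [phi [p Pphi]]; exists (FNot phi), p => e /=; rewrite Pphi. Qed.

Lemma dfn_and (P Q : env -> Prop) :
  dfn P -> dfn Q -> dfn (fun e => P e /\ Q e).
Proof.
move=> [phi [p Pphi]] [psi [q Qpsi]].
(* Both formulas read the merged list [mix p q]: [p] sits at its even positions, [q] at its odd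
   ones. *)
pose r1 i := if odd i then (i./2.*2).*2.+1 else i.
pose r2 i := if odd i then (i./2.*2.+1).*2.+1 else i.
exists (FAnd (frename r1 phi) (frename r2 psi)), (mix p q) => e /=.
rewrite !sat_frename Pphi Qpsi.
suff [-> ->] : mix e p = mix e (mix p q) \o r1 /\ mix e q = mix e (mix p q) \o r2.
  by [].
split; apply/funext => i; rewrite /mix /r1 /r2 /=; case: (boolP (odd i)) => io.
- by rewrite /= odd_double /= uphalf_double odd_double doubleK.
- by rewrite (negbTE io).
- by rewrite /= odd_double /= uphalf_double /= odd_double /= uphalf_double.
- by rewrite (negbTE io).
Qed.

Lemma dfn_or (P Q : env -> Prop) :
  dfn P -> dfn Q -> dfn (fun e => P e \/ Q e).
Proof.
move=> dP dQ; apply: (@eq_dfn (fun e => ~ (~ P e /\ ~ Q e))).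
  by move=> e; rewrite not_andE !notE.
by apply: dfn_not; apply: dfn_and; exact: dfn_not.
Qed.

Lemma dfn_imp (P Q : env -> Prop) :
  dfn P -> dfn Q -> dfn (fun e => P e -> Q e).
Proof.
move=> dP dQ; apply: (@eq_dfn (fun e => ~ P e \/ Q e)).
  by move=> e; rewrite implyE.
by apply: dfn_or => //; exact: dfn_not.
Qed.

Lemma dfn_ex (P : R -> env -> Prop) :
  dfn (fun e => P (e 0%N) (fun i => e i.+1)) -> dfn (fun e => exists a, P a e).
Proof.
move=> [phi [p Pphi]].
(* The bound variable moves all indices by one, which swaps the parities of variables and
   parameters. The bound variable itself stays at [0], since [0.-1 = 0]. *)
exists (FEx (frename (fun i => if odd i then i.+1 else i.-1) phi)), p => e /=.
suff E a : mix (scons a e) p =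
    scons a (mix e p) \o (fun i => if odd i then i.+1 else i.-1).
  split=> -[a]; first by move=> Pa; exists a; rewrite sat_frename -E -Pphi.
  by rewrite sat_frename -E -Pphi => Pa; exists a.
apply/funext => -[|[|i]] //=; rewrite /mix /= negbK.
by case: (boolP (odd i)) => io /=; rewrite ?negbK ?io ?(negbTE io).
Qed.

Lemma dfn_all (P : R -> env -> Prop) :
  dfn (fun e => P (e 0%N) (fun i => e i.+1)) -> dfn (fun e => forall a, P a e).
Proof.
move=> dP; apply: (@eq_dfn (fun e => ~ exists a, ~ P a e)).
  move=> e; split=> [H a|H [a]]; last by apply; exact: H.
  by apply: contrapT => nPa; apply: H; exists a.
by apply: dfn_not; apply: (@dfn_ex (fun a e => ~ P a e)); exact: dfn_not.
Qed.

Lemma dfn_sub (P : R -> env -> Prop) (t : env -> R) :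
  dfn (fun e => P (e 0%N) (fun i => e i.+1)) -> dfun t -> dfn (fun e => P (t e) e).
Proof.
move=> dP dt; apply: (@eq_dfn (fun e => exists a, a = t e /\ P a e)).
  by move=> e; split=> [[a [->]]|] //; exists (t e).
by apply: (@dfn_ex (fun a e => a = t e /\ P a e)); exact: dfn_and.
Qed.

Lemma dfun_rename (t : env -> R) (r : nat -> nat) :
  dfun t -> dfun (fun e => t (fun i => e (r i))).
Proof. by move=> dt; exact: (dfn_rename (up r) dt). Qed.

Lemma dfun_var i : dfun (fun e => e i).
Proof.
exists (FEq (TVar L 0) (TVar L (i.+1).*2)), (fun=> 0) => e /=.
by rewrite /mix /= negbK odd_double doubleK.
Qed.

Lemma dfun_cst c : dfun (fun=> c).
Proof. by exists (FEq (TVar L 0) (TVar L 1)), (fun=> c) => e. Qed.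

Lemma dfun_sub (G : R -> env -> R) (t : env -> R) :
  dfun (fun e => G (e 0%N) (fun i => e i.+1)) -> dfun t -> dfun (fun e => G (t e) e).
Proof.
move=> dG dt; have dt' := dfun_rename succn dt.
apply: (@dfn_sub (fun a e => e 0%N = G a (fun i => e i.+1)) _ _ dt').
exact: (dfn_rename (fun i => if i is j.+1 then (if j is k.+1 then k.+2 else 0%N) else 1%N) dG).
Qed.

Lemma dfn_app1 (X : R -> Prop) s :
  dfn (fun e => X (e 0%N)) -> dfun s -> dfn (fun e => X (s e)).
Proof. by move=> dX ds; exact: (@dfn_sub (fun a _ => X a)). Qed.

Lemma dfn_app2 (X : R -> R -> Prop) s t :
  dfn (fun e => X (e 0%N) (e 1%N)) -> dfun s -> dfun t ->
  dfn (fun e => X (s e) (t e)).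
Proof.
move=> dX ds dt; apply: (@dfn_sub (fun a e => X a (t e))) => //.
apply: (@dfn_sub (fun b e => X (e 0%N) b) (fun e => t (fun i => e i.+1))).
  exact: (dfn_rename (fun i => if i is 0 then 1%N else 0%N) dX).
exact: dfun_rename.
Qed.

Lemma dfun_app1 (F : R -> R) s :
  dfun (fun e => F (e 0%N)) -> dfun s -> dfun (fun e => F (s e)).
Proof. by move=> dF ds; exact: (@dfun_sub (fun a _ => F a)). Qed.

Lemma dfn_eq s t : dfun s -> dfun t -> dfn (fun e => s e = t e).
Proof.
apply: (@dfn_app2 (fun x y => x = y)).
by exists (FEq (TVar L 0) (TVar L 2)), (fun=> 0).
Qed.

(** Iterates [dfn_sub]; needed to substitute a whole row vector in [dfn_vec]. *)
Lemma dfn_subst k (P : env -> Prop) (t : nat -> env -> R) :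
  dfn P -> (forall i, (i < k)%N -> dfun (t i)) ->
  dfn (fun e => P (fun i => if (i < k)%N then t i e else e (i - k)%N)).
Proof.
elim: k t => [|k IH] t dP dt.
  by apply: eq_dfn dP => e; rewrite (_ : (fun i => _) = e) //;
     apply/funext => i /=; rewrite subn0.
pose t' i (e : env) := t i (fun j => e j.+1).
have dt' i : (i < k)%N -> dfun (t' i).
  by move=> ik; apply: dfun_rename; apply: dt; exact: leqW.
apply: (@eq_dfn _ _ _ (@dfn_sub (fun a e => P (fun i => if (i < k)%N then t i e
   else scons a e (i - k)%N)) (t k) _ (dt k (leqnn _)))) => [e|].
  rewrite (_ : (fun i => _) = (fun i =>
    if (i < k.+1)%N then t i e else e (i - k.+1)%N)) //.
  apply/funext => i /=; case: (ltngtP i k) => ik.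
  - by rewrite leqW.
  - by rewrite ltnS leqNgt ik /=; have -> : (i - k = (i - k.+1).+1)%N by lia.
  - by rewrite ik ltnS leqnn subnn.
apply: eq_dfn (IH t' dP dt') => e.
rewrite (_ : (fun i => _) = (fun i => if (i < k)%N then t i (fun j => e j.+1) else
  scons (e 0%N) (fun j => e j.+1) (i - k)%N)) //.
by apply/funext => i; case: ifP => // _; case: (i - k)%N.
Qed.

Lemma definable_dfn n (X : set 'rV[R]_n) :
  definable S X -> dfn (fun e => X (\row_(i < n) e i)).
Proof.
move=> [phi [p Xphi]].
exists (frename (fun i => if (i < n)%N then i.*2 else (i - n).*2.+1) phi), p => e.
rewrite sat_frename Xphi; set x := point_env _ _; set y := _ \o _.
suff -> : x = y by [].
apply/funext => i; rewrite /x /y /point_env /mix /=; case: insubP => [j ij ji|/negbTE ->].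
  by rewrite ij odd_double doubleK mxE ji.
by rewrite /= odd_double /= uphalf_double.
Qed.

Lemma dfn_definable n (X : set 'rV[R]_n) :
  dfn (fun e => X (\row_(i < n) e i)) -> definable S X.
Proof.
move=> [phi [p Xphi]].
(* The row has only [n] coordinates, but [phi] may mention later variables: all of them are sent to
   index [n], where [point_env] reads [p 0]. Accordingly [e] below extends [v] by the constant
   [p 0]. *)
exists (frename (fun i => if odd i then (n + i./2)%N else
  if (i./2 < n)%N then i./2 else n) phi), p => v.
pose e i := if insub i is Some j then v ord0 (j : 'I_n) else p 0%N.
have -> : v = \row_(i < n) e i.
  by apply/rowP => i; rewrite mxE /e valK.
rewrite Xphi sat_frename; set x := mix _ _; set y := _ \o _.
suff -> : x = y by [].
apply/funext => i; rewrite /x /y /point_env /mix /= /e; case: (boolP (odd i)) => io.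
  by case: insubP => [j|_]; [rewrite ltnNge leq_addr|rewrite addKn].
case: insubP => [j ij ji|ij].
  by rewrite ij; case: insubP => [j' _ /= ji'|]; rewrite ?ij // mxE ji' -ji valK.
by rewrite (negbTE ij); case: insubP => [j|]; rewrite ?ltnn // subnn.
Qed.

Lemma dfn_vec n (X : set 'rV[R]_n) (v : env -> 'rV[R]_n) :
  definable S X -> (forall i, dfun (fun e => v e ord0 i)) -> dfn (fun e => X (v e)).
Proof.
move=> /definable_dfn dX dv.
pose t k e := if insub k is Some i then v e ord0 (i : 'I_n) else 0.
have dt k : (k < n)%N -> dfun (t k).
  by move=> kn; rewrite /t; case: insubP => [i _ _|/negP//]; exact: dv.
apply: eq_dfn (dfn_subst (k := n) (t := t) dX dt) => e.
rewrite (_ : (\row_i _) = v e) //; apply/rowP => i.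
by rewrite mxE ltn_ord /t valK.
Qed.

Hypothesis S_exp : expands_ordered_group S.

Lemma dfn_lt s t : dfun s -> dfun t -> dfn (fun e => s e < t e).
Proof.
apply: (@dfn_app2 (fun x y => x < y)).
have [[r rP] _] := S_exp.
exists (FRel r (fun i : 'I_2 => TVar L i.*2)), (fun=> 0) => e /=.
by rewrite rP.
Qed.

Lemma dfn_le s t : dfun s -> dfun t -> dfn (fun e => s e <= t e).
Proof.
move=> ds dt; apply: (@eq_dfn (fun e => ~ t e < s e)).
  by move=> e; rewrite leNgt; split=> /negP.
by apply: dfn_not; exact: dfn_lt.
Qed.

Lemma dfun_add s t : dfun s -> dfun t -> dfun (fun e => s e + t e).
Proof.
move=> ds dt.
apply: (@dfn_sub (fun a e => e 0%N = a + t (fun i => e i.+1)) (fun e => s (fun i => e i.+1))).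
  apply: (@dfn_sub (fun b e => e 1%N = e 0%N + b) (fun e => t (fun i => e i.+2))).
    have [_ [f fP]] := S_exp.
    exists (FEq (TVar L 4) (TApp f (fun i : 'I_2 => TVar L (if i == ord0 then 2 else 0)))).
    by exists (fun=> 0) => e /=; rewrite fP.
  exact: (dfun_rename (fun i => i.+2) dt).
exact: dfun_rename.
Qed.

Lemma dfun_sub2 s t : dfun s -> dfun t -> dfun (fun e => s e - t e).
Proof.
move=> ds dt; apply: (@eq_dfn (fun e => e 0%N + t (fun i => e i.+1) = s (fun i => e i.+1))).
  by move=> e; split=> [<-|->]; rewrite ?addrK ?subrK.
apply: dfn_eq; last exact: dfun_rename.
by apply: dfun_add; [exact: dfun_var|exact: dfun_rename].
Qed.

Lemma dfun_opp s : dfun s -> dfun (fun e => - s e).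
Proof.
move=> ds; rewrite (_ : (fun e => _) = (fun e => 0 - s e)).
  by apply: dfun_sub2 => //; exact: dfun_cst.
by apply/funext => e; rewrite sub0r.
Qed.

End DefinablePredicates.

(* Definability of the relations and functions that occur is looked up among
   the hypotheses. *)
Ltac dfn_tac :=
  repeat first
  [ assumption
  | match goal with
    | |- dfn _ (fun e => ~ _) => apply: dfn_not
    | |- dfn _ (fun e => _ /\ _) => apply: dfn_and
    | |- dfn _ (fun e => _ \/ _) => apply: dfn_or
    | |- dfn _ (fun e => exists a : _, @?P e a) =>
        refine (@dfn_ex _ _ _ (fun a e => P e a) _); cbv beta
    | |- dfn _ (fun e => @?P e -> @?Q e) => apply: dfn_imp
    | |- dfn _ (fun e => forall a : _, @?P e a) =>
        refine (@dfn_all _ _ _ (fun a e => P e a) _); cbv beta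
    | |- dfn _ (fun e => _ = _) => apply: dfn_eq
    | |- dfn _ (fun e => is_true (_ < _)) => apply: dfn_lt => //
    | |- dfn _ (fun e => is_true (_ <= _)) => apply: dfn_le => //
    | |- dfun _ (fun e => e _) => exact: dfun_var
    | |- dfun _ (fun e => ?c) => exact: dfun_cst
    | |- dfun _ (fun e => _ - _) => apply: dfun_sub2 => //
    | |- dfun _ (fun e => _ + _) => apply: dfun_add => //
    | |- dfun _ (fun e => - _) => apply: dfun_opp => //
    | H : dfn _ (fun e => ?X (e 0%N)) |- dfn _ (fun e => ?X _) =>
        apply: (dfn_app1 H)
    | H : dfn _ (fun e => ?X (e 0%N) (e 1%N)) |- dfn _ (fun e => ?X _ _) =>
        apply: (dfn_app2 H)
    | H : dfun _ (fun e => ?F (e 0%N)) |- dfun _ (fun e => ?F _) =>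
        apply: (dfun_app1 H)
    end ].

(** * Orderings of type omega *)

(** The number [rk x] of predecessors is strictly increasing, hence injective, hence unbounded on an
    infinite set; since it skips no value, its inverse is the enumeration. *)
Lemma omega_enumeration (T : choiceType) (X : set T) (prec : T -> T -> Prop) :
  infinite_set X ->
  (forall x, ~ prec x x) ->
  (forall x y z, X x -> X y -> X z -> prec x y -> prec y z -> prec x z) ->
  (forall x y, X x -> X y -> x <> y -> prec x y \/ prec y x) ->
  (forall x, X x -> finite_set [set y | X y /\ prec y x]) ->
  exists g : nat -> T, set_bij [set: nat] X g /\
    forall i j : nat, (i < j)%N <-> prec (g i) (g j).
Proof.
move=> Xinf irr tr tot fin.
pose below x : seq T := finmap.enum_fset (fset_set [set y | X y /\ prec y x]).
pose rk x := size (below x).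
have belowP x y : X x -> reflect (X y /\ prec y x) (y \in below x).
  move=> Xx; apply: (iffP idP); rewrite (in_fset_set (fin _ Xx)).
    by rewrite inE.
  by move=> ?; rewrite inE.
have rk_lt x y : X x -> X y -> prec x y -> (rk x < rk y)%N.
  move=> Xx Xy xy; rewrite -/(size (x :: below x)); apply: uniq_leq_size.
    rewrite /= finmap.fset_uniq andbT; apply/negP => /(belowP _ _ Xx)[_].
    exact: irr.
  move=> z; rewrite inE => /orP[/eqP ->|/(belowP _ _ Xx)[Xz zx]].
    by apply/belowP.
  by apply/belowP => //; split => //; exact: tr zx xy.
have rk_inj x y : X x -> X y -> rk x = rk y -> x = y.
  move=> Xx Xy xy; apply: contrapT => /(tot _ _ Xx Xy)[] /rk_lt; rewrite xy ltnn.
    by move=> /(_ Xx Xy).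
  by move=> /(_ Xy Xx).
have unbounded n : exists2 x, X x & (n <= rk x)%N.
  apply: contrapT => H; apply: Xinf.
  have rkX : {in X &, injective rk}.
    by move=> x y; rewrite !inE; exact: rk_inj.
  rewrite -(eq_finite_set (inj_card_eq rkX)).
  apply: sub_finite_set (finite_II n) => _ [x Xx <-] /=.
  by rewrite ltnNge; apply/negP => ?; apply: H; exists x.
have onto n : exists x, X x /\ rk x = n.
  have [x Xx] := unbounded n; move: {2}(rk x) (leqnn (rk x)) => k.
  elim: k x Xx => [|k IH] x Xx xk nx; first by exists x; split=> //; lia.
  have [->|xn] := eqVneq n (rk x); first by exists x.
  (* Descent to rank [n]: if all predecessors of [x] had rank below [n], their ranks would be
     distinct numbers below [n], so [rk x] would be at most [n]. *)
  suff [y [Xy yx] ny] : exists2 y, X y /\ prec y x & (n <= rk y)%N.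
    by apply: (IH y) => //; have := rk_lt _ _ Xy Xx yx; lia.
  apply: contrapT => H.
  have : (rk x <= n)%N.
    rewrite -[n in (_ <= n)%N](size_iota 0) /rk -(size_map rk); apply: uniq_leq_size.
      rewrite map_inj_in_uniq ?finmap.fset_uniq //.
      by move=> y z /(belowP _ _ Xx)[? _] /(belowP _ _ Xx)[? _]; exact: rk_inj.
    move=> _ /mapP[y /(belowP _ _ Xx) yx ->]; rewrite mem_iota /= add0n ltnNge.
    by apply/negP => ny; apply: H; exists y.
  by rewrite leq_eqVlt eq_sym (negbTE xn) ltnNge nx.
have /choice[g gP] := onto.
exists g; split; first split.
- by move=> n _; exact: (gP n).1.
- by move=> i j _ _ gij; rewrite -(gP i).2 gij (gP j).2.
- move=> x Xx; exists (rk x) => //; apply: rk_inj => //; first exact: (gP _).1.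
  exact: (gP _).2.
- move=> i j; have [Xi ri] := gP i; have [Xj rj] := gP j.
  split=> [ij|/(rk_lt _ _ Xi Xj)]; last by rewrite ri rj.
  have [|//|/(rk_lt _ _ Xj Xi)] := tot _ _ Xi Xj.
    by move=> gij; move: ij; rewrite -ri -rj gij ltnn.
  by rewrite ri rj ltnNge ltnW.
Qed.

(** * Type A as a definable Baire principle *)

Section TypeA.
Context (R : realType) (L : language) (S : structure L R).
Hypothesis S_exp : expands_ordered_group S.

Definition nowhere_dense (X : R -> Prop) : Prop := forall p q : R, p < q ->
  exists u v, [/\ p <= u, u < v, v <= q & forall x, u < x -> x < v -> ~ X x].

Definition dense_between (X : R -> Prop) (p q : R) : Prop := forall u v : R,
  p <= u -> u < v -> v <= q -> exists x, [/\ u < x, x < v & X x].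

Lemma not_nowhere_dense (X : R -> Prop) : ~ nowhere_dense X -> exists p q, p < q /\ dense_between X p q.
Proof.
move=> H; apply: contrapT => H'; apply: H => p q pq; apply: contrapT => H.
apply: H'; exists p, q; split=> // u v pu uv vq; apply: contrapT => H'.
by apply: H; exists u, v; split=> // x ux xv Xx; apply: H'; exists x.
Qed.

Lemma not_dense_between (X : R -> Prop) (p q : R) : nowhere_dense X -> p < q -> ~ dense_between X p q.
Proof.
move=> Xn pq XD; have [u [v [pu uv vq H]]] := Xn _ _ pq.
by have [x [ux xv Xx]] := XD u v pu uv vq; exact: H Xx.
Qed.

Hypothesis S_A : type_A S.

(* Elements are ordered by the scale at which they appear, then by [<]. *)
Lemma nowhere_dense_union_finite (Y : R -> R -> Prop) :
  dfn S (fun e => Y (e 0%N) (e 1%N)) ->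
  (forall s t x : R, 0 < s -> s <= t -> Y t x -> Y s x) ->
  (forall t : R, 0 < t -> finite_set (Y t)) ->
  nowhere_dense (fun x => exists t : R, 0 < t /\ Y t x).
Proof.
move=> dY mono fin; apply: contrapT => /not_nowhere_dense[p [q [pq XD]]].
set X := fun x => exists t : R, 0 < t /\ Y t x in XD.
have dX : dfn S (fun e => X (e 0%N)) by rewrite /X; dfn_tac.
apply: S_A; exists X; split; last first.
  exists `]p, q[%classic; split.
  - by exists ((p + q) / 2) => /=; rewrite in_itv /=; apply/andP; split; lra.
  - exact: interval_open.
  - exact: interval_is_interval.
  - move=> x /=; rewrite in_itv /= => /andP[px xq] B /nbhs_ballP[r /= r0 rB].
    have [|||y [y1 y2 Xy]] := XD (Num.max p (x - r)) (Num.min q (x + r)).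
    + by rewrite le_max lexx.
    + by rewrite gt_max !lt_min; apply/andP; split; apply/andP; split; lra.
    + by rewrite ge_min lexx.
    move: y1 y2; rewrite gt_max lt_min => /andP[py xy] /andP[yq yx].
    exists y; split; last apply: rB.
      by split=> //=; rewrite in_itv /= py.
    by rewrite /ball /= ltr_distlC; apply/andP; split; lra.
split.
  apply: dfn_definable; apply: eq_dfn dX => e.
  by rewrite /vec_set /= mxE.
have [Xfin|Xinf] := pselect (finite_set X).
  left; apply: (sub_finite_set _ (finite_image (fun x => \row_(i < 1) x) Xfin)).
  by move=> v Xv; exists (v ord0 ord0) => //; apply/rowP => i; rewrite (ord1 i) mxE.
right.
(* As [t] decreases to 0 the sets [Y t] grow; [A x y] says that [x] appears before [y]. Points that
   appear together are ordered by [<]. *)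
pose A x y := exists t, [/\ 0 < t, Y t x & ~ Y t y].
pose lt x y := A x y \/ (~ A y x /\ x < y).
have [||||g [gbij glt]] := @omega_enumeration _ X lt Xinf.
- by move=> x [[t []]//|[_]]; rewrite ltxx.
- have Atr x y z : A x y -> ~ A z y -> A x z.
    move=> [t [t0 tx ty]] zy; exists t; split=> // tz.
    by apply: zy; exists t.
  have Atr' x y z : ~ A y x -> A y z -> A x z.
    move=> yx [t [t0 ty tz]]; exists t; split=> //.
    by apply: contrapT => tx; apply: yx; exists t.
  have Aasym x y : A x y -> ~ A y x.
    move=> [t [t0 tx ty]] [s [s0 sy sx]].
    by have [st|/ltW ts] := leP s t; [apply: sx; apply: mono tx|apply: ty; apply: mono sy].
  move=> x y z _ _ _ [xy|[xy ltxy]] [yz|[yz ltyz]].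
  + by left; apply: (Atr _ _ _ xy); exact: Aasym.
  + by left; exact: Atr yz.
  + by left; exact: Atr' yz.
  + right; split; last exact: lt_trans ltyz.
    by move=> zx; apply: yz; apply: Atr zx xy.
- move=> x y Xx Xy xy.
  have [Axy|Axy] := pselect (A x y); first by left; left.
  have [Ayx|Ayx] := pselect (A y x); first by right; left.
  by case: (ltgtP x y) xy => // ? _; [left|right]; right.
(* Whatever precedes [x] has appeared by any scale [t] at which [x] is present, so it lies in the
   finite set [Y t]. *)
- move=> x [t [t0 tx]]; apply: sub_finite_set (fin t t0) => y [Xy [|[]]].
    move=> [s [s0 sy sx]]; have [st|ts] := leP s t.
      by exfalso; apply: sx; apply: mono tx.
    by apply: mono sy => //; exact: ltW.
  by move=> xy _; apply: contrapT => ty; apply: xy; exists t.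
exists (fun v w => lt (v ord0 ord0) (w ord0 ord0)); split.
  apply: dfn_definable.
  apply: (@eq_dfn _ _ _ (fun e => X (e 0%N) /\ X (e 1%N) /\ lt (e 0%N) (e 1%N))).
    move=> e; rewrite /vec_set /= !mxE /=.
    by split=> [[? [? ?]]|[? ? ?]].
  have dA : dfn S (fun e => A (e 0%N) (e 1%N)).
    apply: (@eq_dfn _ _ _ (fun e => exists t : R, 0 < t /\ Y t (e 0%N) /\ ~ Y t (e 1%N))).
      by move=> e; split=> -[t]; [move=> [? []]|move=> []] => *; exists t.
    by dfn_tac.
  by rewrite /lt; dfn_tac.
exists (fun n => \row_(i < 1) g n); split; last first.
  by move=> i j; rewrite !mxE.
have [gX ginj gsurj] := gbij; split.
- by move=> n _; rewrite /vec_set /= mxE; exact: gX.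
- by move=> i j _ _ /rowP/(_ ord0); rewrite !mxE; apply: ginj; rewrite inE.
- move=> v /gsurj[n _ gn]; exists n => //.
  by apply/rowP => i; rewrite (ord1 i) mxE gn.
Qed.

(** Cut the line into cells of length [s] starting at [a]: each cell holds at most one point of [A],
    and [h] is the index of the cell. *)
Lemma finite_separated (A : set R) (a b s : R) : 0 < s ->
  (forall x, A x -> a <= x <= b) ->
  (forall x y, A x -> A y -> x < y -> x + s <= y) -> finite_set A.
Proof.
move=> s0 Aab sep; pose h x := Num.truncn ((x - a) / s).
have hP x : A x -> (h x)%:R * s <= x - a < (h x).+1%:R * s.
  move=> /Aab /andP[ax xb]; rewrite -ler_pdivlMr // -ltr_pdivrMr //.
  by apply: truncn_itv; rewrite divr_ge0 ?subr_ge0 // ltW.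
have hlt x y : A x -> A y -> x < y -> h x <> h y.
  move=> Ax Ay xy hxy; have := sep _ _ Ax Ay xy.
  have := hP _ Ax; have := hP _ Ay; rewrite hxy -natr1 mulrDl mul1r.
  by move=> /andP[? ?] /andP[? ?]; lra.
have hinj : {in A &, injective h}.
  move=> x y; rewrite !inE => Ax Ay hxy.
  by case: (ltgtP x y) => // xy; [case: (hlt x y)|case: (hlt y x)].
rewrite -(eq_finite_set (inj_card_eq hinj)).
apply: sub_finite_set (finite_II (Num.truncn ((b - a) / s)).+1) => _ [x Ax <-] /=.
rewrite ltnS; apply: le_truncn; rewrite ler_pM2r ?invr_gt0 //.
by have /andP[] := Aab _ Ax; lra.
Qed.

(** Since [y = x] is allowed, this is the closure of [X] for the topology of the intervals []u, x]];
    every point of [X] satisfies it. *)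
Definition left_adherent (X : R -> Prop) (x : R) : Prop :=
  forall u : R, u < x -> exists y : R, [/\ u < y, y <= x & X y].

Definition right_adherent (X : R -> Prop) (x : R) : Prop :=
  forall v : R, x < v -> exists y : R, [/\ x <= y, y < v & X y].

(** The supremum of the part of [X] up to [u]. As [X] need not be closed, the supremum is only
    adherent to it. *)
Lemma last_point (X : R -> Prop) (z u : R) : X z -> z <= u ->
  exists x, [/\ z <= x, x <= u, left_adherent X x & forall w, x < w -> w <= u -> ~ X w].
Proof.
move=> Xz zu; pose E := [set w | X w /\ w <= u].
have Eub : has_ubound E by exists u => w [].
have Esup : has_sup E by split=> //; exists z.
have le_sup w : X w -> w <= u -> w <= sup E by move=> ? ?; exact: ub_le_sup.
exists (sup E); split.
- exact: le_sup.
- by apply: ge_sup; [exists z|move=> w []].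
- move=> v vE; have [|w [Xw wu] vw] := @sup_adherent _ E (sup E - v) _ Esup.
    by rewrite subr_gt0.
  by exists w; split=> //; [lra|exact: le_sup].
- by move=> w Ew wu /le_sup -/(_ wu); rewrite leNgt Ew.
Qed.

Lemma first_point (X : R -> Prop) (z u : R) : X z -> u <= z ->
  exists x, [/\ u <= x, x <= z, right_adherent X x & forall w, w < x -> u <= w -> ~ X w].
Proof.
move=> Xz uz; have [||x [zx xu xl xX]] := @last_point (fun w => X (- w)) (- z) (- u).
- by rewrite opprK.
- by rewrite lerN2.
exists (- x); split=> [|||w wx uw Xw]; [lra|lra| |].
  move=> v xv; have [|y [vy yx Xy]] := xl (- v); first lra.
  by exists (- y); split=> //; lra.
by apply: (xX (- w)); [lra|lra|rewrite opprK].
Qed.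

Definition gap (X : R -> Prop) (x s : R) : Prop :=
  left_adherent X x /\ forall y, x < y -> y < x + s -> ~ X y.

(** Left ends of gaps of length at least [s] are [s] apart: a later left end is adherent from the
    left, so a point of [X] separates it from the earlier one. *)
Lemma finite_gaps (X : R -> Prop) (a b s : R) : 0 < s ->
  finite_set [set x | a < x /\ x < b /\ gap X x s].
Proof.
move=> s0; apply: (@finite_separated _ a b s) => //.
  by move=> x [ax [xb _]]; rewrite !ltW.
move=> x y [_ [_ [_ xX]]] [_ [_ [yl _]]] xy; rewrite leNgt; apply/negP => yx.
have [z [xz zy Xz]] := yl _ xy.
by apply: (xX z) => //; exact: le_lt_trans yx.
Qed.

(* If some X t is infinite, the lengths D of its gaps form a sequence
   converging to 0; left endpoints of gaps of X t of length at least s, with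
   t and s in D, then exhaust a dense set by finite sets. *)
Lemma nowhere_dense_union (X : R -> R -> Prop) :
  dfn S (fun e => X (e 0%N) (e 1%N)) ->
  (forall s t x : R, 0 < s -> s <= t -> X t x -> X s x) ->
  (forall t : R, 0 < t -> nowhere_dense (X t)) ->
  nowhere_dense (fun x => exists t : R, 0 < t /\ X t x).
Proof.
move=> dX mono Xn; apply: contrapT => /not_nowhere_dense[a [b [ab XD]]].
pose lclX t := left_adherent (X t); pose rclX t := right_adherent (X t).
have dlcl : dfn S (fun e => lclX (e 0%N) (e 1%N)).
  apply: (@eq_dfn _ _ _ (fun e => forall u, u < e 1%N ->
    exists y, u < y /\ y <= e 1%N /\ X (e 0%N) y)); last by dfn_tac.
  move=> e; split=> H u /H[y].
    by move=> [? [? ?]]; exists y.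
  by move=> [? ? ?]; exists y.
have drcl : dfn S (fun e => rclX (e 0%N) (e 1%N)).
  apply: (@eq_dfn _ _ _ (fun e => forall u, e 1%N < u ->
    exists y, e 1%N <= y /\ y < u /\ X (e 0%N) y)); last by dfn_tac.
  move=> e; split=> H u /H[y].
    by move=> [? [? ?]]; exists y.
  by move=> [? ? ?]; exists y.
have [[D [dD D0 Dfin Dinf]]|noD] := pselect (exists D : R -> Prop,
  [/\ dfn S (fun e => D (e 0%N)), (forall d : R, D d -> 0 < d),
     (forall r : R, 0 < r -> finite_set [set d | D d /\ r <= d]) &
     (forall r : R, 0 < r -> exists d, D d /\ d < r)]).
  pose Y r x := (a < x /\ x < b) /\ exists t s : R, D t /\ D s /\ r <= t /\ r <= s /\
    (lclX t x /\ forall y, x < y -> y < x + s -> ~ X t y).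
  have dY : dfn S (fun e => Y (e 0%N) (e 1%N)) by rewrite /Y; dfn_tac.
  apply: (@not_dense_between _ a b (@nowhere_dense_union_finite Y dY _ _) ab).
  - move=> s t x s0 st [xab [t' [s' [? [? [? [? ?]]]]]]]; split=> //.
    by exists t', s'; repeat split; intuition; exact: le_trans st _.
  - move=> r r0.
    apply: (@sub_finite_set _ _ (\bigcup_(t in [set d | D d /\ r <= d])
      \bigcup_(s in [set d | D d /\ r <= d]) [set x | a < x /\ x < b /\ gap (X t) x s])).
      by move=> x [[ax xb] [t [s [? [? [? [? ?]]]]]]]; exists t => //; exists s.
    apply: bigcup_finite => [|t _]; first exact: Dfin.
    apply: bigcup_finite => [|s [Ds _]]; first exact: Dfin.
    by apply: finite_gaps; exact: D0.
  - move=> p q ap pq qb.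
    have [x [px xq [t0 [t00 Xx]]]] := XD _ _ ap pq qb.
    have [t [Dt tt0]] := Dinf _ t00.
    have {}Xx : X t x by apply: mono Xx; [exact: D0|exact: ltW].
    (* The hole []u, v[] to the right of [x] extends leftwards to a gap with left end [x1] in []p,
       q[], and [D] contains some [s] below [v - x1]. *)
    have [u [v [xu uv vq Xuv]]] := Xn t (D0 _ Dt) _ _ xq.
    have [x1 [xx1 x1u x1l x1X]] := last_point Xx xu.
    have [|s [Ds sv]] := Dinf (v - x1); first lra.
    exists x1; split; [lra|lra|].
    exists (Num.min t s); split; first by rewrite lt_min !D0.
    split; first by split; lra.
    exists t, s; rewrite !ge_min !lexx orbT; repeat split => //.
    move=> y xy yx; have [yu|uy] := leP y u; first exact: x1X.
    by apply: Xuv => //; lra.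
have XYfin t : 0 < t -> finite_set [set x | (a < x /\ x < b) /\ X t x].
  move=> t0.
  (* [P s x]: []x, x + s[] is a maximal gap of [X t], so that [x] determines [s]. Hence only
     finitely many lengths exceed a given [r], and as no suitable [D] exists, all lengths are
     bounded below by some [r]. *)
  pose P s x := a < x /\ x + s < b /\
    (lclX t x /\ (forall y, x < y -> y < x + s -> ~ X t y)) /\ rclX t (x + s).
  pose D s := 0 < s /\ exists x, P s x.
  have [r [r0 rD]] : exists r : R, 0 < r /\ forall d, D d -> r <= d.
    apply: contrapT => H; apply: noD; exists D; split.
    - by rewrite /D /P; dfn_tac.
    - by move=> d [].
    - move=> r r0; apply: (@sub_finite_set _ _
        (\bigcup_(x in [set x | a < x /\ x < b /\ gap (X t) x r])
           [set s | 0 < s /\ P s x])).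
        move=> s [[s0 [x Px]] rs]; exists x => //; have [ax [xb [[xl xX] _]]] := Px.
        by repeat split => //; [lra|move=> y xy yx; apply: xX => //; lra].
      apply: bigcup_finite => [|x _]; first exact: finite_gaps.
      have sub s s' : 0 < s -> P s x -> P s' x -> s' <= s.
        move=> s0 [_ [_ [_ xr]]] [_ [_ [[_ xX] _]]]; rewrite leNgt; apply/negP => ss'.
        have [|y [xy yx Xy]] := xr (x + s'); first by lra.
        by apply: (xX y) => //; lra.
      have [[s0 Ps0]|nP] := pselect (exists s, 0 < s /\ P s x); last first.
        apply: (@sub_finite_set _ _ set0) => // s Ps.
        by exfalso; apply: nP; exists s.
      apply: (@sub_finite_set _ _ [set s0]) => // s [Ps1 Ps2] /=.
      by apply/eqP; rewrite eq_le !sub //; case: Ps0.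
    - move=> r r0; apply: contrapT => H'; apply: H; exists r; split=> // d Dd.
      by rewrite leNgt; apply/negP => dr; apply: H'; exists d.
  apply: (@finite_separated _ a b r) => //.
    by move=> x [[ax xb] _]; rewrite !ltW.
  move=> x y [[ax xb] Xx] [[ay yb] Xy] xy; rewrite leNgt; apply/negP => yx.
  (* Between two points of [X t] there is a hole; enlarged to a maximal gap []x1, y1[] it has length
     at least [r], so the two points are [r] apart. *)
  have [u [v [xu uv vy Xuv]]] := Xn t t0 _ _ xy.
  have [x1 [xx1 x1u x1l x1X]] := last_point Xx xu.
  have [y1 [vy1 y1y y1r y1X]] := first_point Xy vy.
  have : r <= y1 - x1; last by lra.
  apply: rD; split; first lra.
  exists x1; rewrite /P subrKC; split; first lra.
  split; first lra.
  split=> //; split=> // w xw wy.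
  have [wu|uw] := leP w u; first exact: x1X.
  have [vw|wv] := leP v w; first exact: y1X.
  exact: Xuv.
pose Y t x := (a < x /\ x < b) /\ X t x.
have dY : dfn S (fun e => Y (e 0%N) (e 1%N)) by rewrite /Y; dfn_tac.
apply: (@not_dense_between _ a b (@nowhere_dense_union_finite Y dY _ XYfin) ab).
  by move=> s t x s0 st [xab Xt]; split=> //; exact: mono Xt.
move=> p q ap pq qb; have [x [px xq [t [t0 Xx]]]] := XD _ _ ap pq qb.
by exists x; split=> //; exists t; split=> //; split=> //; split; lra.
Qed.

End TypeA.

(** * Convexity of higher order by iterated differences *)

Section HigherConvexity.
Context (R : realType).
Implicit Types (F G : R -> R) (c d : R).

(* The steps of the m-fold differences are independent of each other. *)
Fixpoint kconvex (m : nat) F c d : Prop :=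
  if m is m'.+1 then
    forall h : R, 0 < h -> kconvex m' (fun x => F (x + h) - F x) c (d - h)
  else forall x : R, c <= x -> x <= d -> 0 <= F x.

Lemma kconvex_ext m F G c d : (forall x, c <= x -> x <= d -> F x = G x) ->
  kconvex m F c d -> kconvex m G c d.
Proof.
elim: m F G c d => [|m IH] F G c d FG /=.
  by move=> F0 x cx xd; rewrite -FG //; exact: F0.
move=> H h h0; apply: IH (H h h0) => x cx xd.
by rewrite !FG //; lra.
Qed.

Lemma kconvex_empty m F c d : d < c -> kconvex m F c d.
Proof.
elim: m F c d => [|m IH] F c d dc /=.
  by move=> x cx xd; have := le_lt_trans (le_trans cx xd) dc; rewrite ltxx.
by move=> h h0; apply: IH; lra.
Qed.

Lemma kconvex_sub m F c d c' d' : c <= c' -> d' <= d -> kconvex m F c d -> kconvex m F c' d'.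
Proof.
elim: m F c d c' d' => [|m IH] F c d c' d' cc dd /=.
  by move=> H x cx xd; apply: H; lra.
by move=> H h h0; apply: IH (H h h0); lra.
Qed.

Lemma kconvex_shift m F c d t : kconvex m F (c + t) (d + t) -> kconvex m (fun x => F (x + t)) c d.
Proof.
elim: m F c d => [|m IH] F c d /=.
  by move=> H x cx xd; apply: H; lra.
move=> H h h0.
apply: (@kconvex_ext _ (fun x => (fun y => F (y + h) - F y) (x + t))).
  by move=> x _ _ /=; rewrite addrAC.
apply: (IH (fun y => F (y + h) - F y)); have := H h h0.
by rewrite (_ : d - h + t = d + t - h) //; lra.
Qed.

Lemma kconvex_add m F G c d : kconvex m F c d -> kconvex m G c d -> kconvex m (fun x => F x + G x) c d.
Proof.
elim: m F G c d => [|m IH] F G c d /=.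
  by move=> HF HG x cx xd; rewrite addr_ge0 ?HF ?HG.
move=> HF HG h h0; apply: kconvex_ext (IH _ _ _ _ (HF h h0) (HG h h0)) => x _ _.
by lra.
Qed.

Lemma kconvex_0 m c d : kconvex m (fun=> 0) c d.
Proof.
elim: m d => [|m IH] d //= h h0.
by apply: kconvex_ext (IH _) => x _ _; rewrite subrr.
Qed.

Lemma kconvex_sum m n (F : nat -> R -> R) c d :
  (forall i, (i < n)%N -> kconvex m (F i) c d) -> kconvex m (fun x => \sum_(i < n) F i x) c d.
Proof.
elim: n => [|n IH] H.
  by apply: kconvex_ext (kconvex_0 m c d) => x _ _; rewrite big_ord0.
apply: (@kconvex_ext _ (fun x => \sum_(i < n) F i x + F n x)).
  by move=> x _ _; rewrite big_ord_recr.
by apply: kconvex_add; [apply: IH => i ?; apply: H; exact: leqW|exact: H].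
Qed.

Lemma kconvex_scale m F c d (a : R) : 0 <= a -> kconvex m F c d -> kconvex m (fun x => a * F x) c d.
Proof.
move=> a0; elim: m F c d => [|m IH] F c d /=.
  by move=> H x cx xd; rewrite mulr_ge0 ?H.
move=> H h h0; apply: kconvex_ext (IH _ _ _ (H h h0)) => x _ _.
by rewrite mulrBr.
Qed.

Lemma closed_kconvex (T : topologicalType) m (G : T -> R -> R) c d :
  (forall x, continuous (fun t => G t x)) -> closed [set t | kconvex m (G t) c d].
Proof.
elim: m G d => [|m IH] G d Gc /=.
  rewrite (_ : mkset _ = \bigcap_(x in [set x | c <= x /\ x <= d])
      ((fun t => G t x) @^-1` [set y | 0 <= y])).
    apply: closed_bigI => x _; apply: closed_comp => [t _|]; first exact: Gc.
    exact: closed_ge.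
  apply/seteqP; split=> t /= H x; first by move=> [? ?]; exact: H.
  by move=> ? ?; exact: H.
rewrite (_ : mkset _ = \bigcap_(h in [set h : R | 0 < h])
    [set t | kconvex m (fun x => G t (x + h) - G t x) c (d - h)]) //.
apply: closed_bigI => h _; apply: IH => x t.
by apply: cvgB; exact: Gc.
Qed.

Lemma kconvex_cvg (T : Type) (f : set_system T) {pf : ProperFilter f} m
    (G : T -> R -> R) F c d :
  (forall x, c <= x -> x <= d -> G t x @[t --> f] --> F x) ->
  (\forall t \near f, kconvex m (G t) c d) -> kconvex m F c d.
Proof.
elim: m G F d => [|m IH] G F d GF H /=.
  move=> x cx xd; apply: (closed_cvg _ (@closed_ge R 0) _ _ (GF x cx xd)).
  by apply: filterS H => t; exact.
move=> h h0; apply: (IH (fun t x => G t (x + h) - G t x)).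
  by move=> x cx xd; apply: cvgB; apply: GF; lra.
by apply: filterS H => t; exact.
Qed.

(* Differences of step h are sums of translates of differences of step h / N. *)
Lemma kconvex_uniform_glue m F c d r : 0 < r ->
  (forall u v, c <= u -> v <= d -> v - u <= r -> kconvex m F u v) -> kconvex m F c d.
Proof.
elim: m F c d r => [|m IH] F c d r r0 H /=.
  by move=> x cx xd; apply: (H x x) => //; rewrite subrr ltW.
move=> h h0; apply: (IH _ _ _ (r / 2)); first by lra.
move=> u v cu vd uv.
(* [N] makes the step [k] smaller than [r / 2]; with an interval of length at most [r / 2], the
   differences of step [k] then stay within length [r]. *)
pose N := (Num.truncn (h / (r / 2))).+1.
have N0 : 0 < N%:R :> R by rewrite ltr0n.
pose k := h / N%:R.
have kr : k < r / 2.
  rewrite ltr_pdivrMr // mulrC -ltr_pdivrMr; last lra.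
  exact: truncnS_gt.
have k0 : 0 < k by rewrite divr_gt0.
have Nk : N%:R * k = h by rewrite mulrC divfK // gt_eqF.
apply: (@kconvex_ext _ (fun x => \sum_(i < N) (F (x + i%:R * k + k) - F (x + i%:R * k)))).
  move=> x _ _.
  rewrite -(big_mkord predT (fun i => F (x + i%:R * k + k) - F (x + i%:R * k))).
  rewrite (@telescope_sumr_eq _ 0 N (fun i => F (x + i%:R * k))) //.
    by rewrite mul0r addr0 Nk.
  by move=> i _; rewrite -natr1 mulrDl mul1r addrA.
apply: (@kconvex_sum m N (fun i x => F (x + i%:R * k + k) - F (x + i%:R * k))) => i iN.
apply: (@kconvex_shift m (fun y => F (y + k) - F y)).
have ik0 : 0 <= i%:R * k by rewrite mulr_ge0 // ltW.
have ikN : i%:R * k + k <= h.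
  by rewrite -Nk -[X in _ + X]mul1r -mulrDl natr1 ler_pM2r // ler_nat.
rewrite (_ : v + i%:R * k = v + i%:R * k + k - k); last by rewrite addrK.
by apply: (H (u + i%:R * k) (v + i%:R * k + k)) => //; lra.
Qed.

(** Let [E] collect the [w] with [F] [m]-convex on [[c, w]]. Gluing across [sup E] shows that [E]
    reaches [d]. *)
Lemma kconvex_glue m F c d : c <= d ->
  (forall x, c <= x -> x <= d -> exists2 r, 0 < r & kconvex m F (x - r) (x + r)) ->
  kconvex m F c d.
Proof.
move=> cd loc; pose E := [set w | [/\ c <= w, w <= d & kconvex m F c w]].
have Ec : E c.
  split=> //; have [r r0] := loc c (lexx _) cd.
  by apply: kconvex_sub; lra.
have Eub : has_ubound E by exists d => w [].
have Esup : has_sup E by split=> //; exists c.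
have cs : c <= sup E by exact: ub_le_sup.
have sd : sup E <= d by apply: ge_sup; [exists c|move=> w []].
have [r r0 sr] := loc _ cs sd.
have [w [cw wd Fw] ws] := @sup_adherent _ E r r0 Esup.
have wsup : w <= sup E by apply: ub_le_sup.
have Emin : E (Num.min (sup E + r) d).
  split; first by rewrite le_min cd andbT; lra.
    by rewrite ge_min lexx orbT.
  (* This is the length of the overlap of [[c, w]] and [[sup E - r, sup E + r]] when [c] lies left
     of both; an interval no longer than it fits into one of the two. *)
  apply: (@kconvex_uniform_glue _ _ _ _ (w - (sup E - r))); first lra.
  move=> u v cu; rewrite le_min => /andP[vr vd] uv.
  have [vw|wv] := leP v w; first by apply: kconvex_sub Fw.
  by apply: kconvex_sub sr; lra.
have := ub_le_sup Eub Emin; rewrite ge_min => /orP[|ds]; first by lra.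
have <- : Num.min (sup E + r) d = d by apply/min_idPr; lra.
by case: Emin.
Qed.

End HigherConvexity.

(** * Baire category and open transitive relations *)

(** Otherwise the complements of the sets [C i], cut down to the middle third [[p', q']], are open
    and dense, and a common point of them in []p', q'[] is not covered. *)
Lemma baire_cover (R : realType) (C : nat -> set R) (p q : R) : p < q ->
  (forall i, closed (C i)) -> (forall t, p < t -> t < q -> exists i, C i t) ->
  exists i u v, [/\ p <= u, u < v, v <= q & forall t, u < t -> t < v -> C i t].
Proof.
move=> pq Ccl cov; apply: contrapT => H.
pose p' := p + (q - p) / 3; pose q' := q - (q - p) / 3.
have [pp' p'q' qq'] : [/\ p < p', p' < q' & q' < q] by rewrite /p' /q'; split; lra.
pose U i := ~` (C i `&` `[p', q']%classic).
have /Baire UD : forall i, open (U i) /\ dense (U i).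
  move=> i; split.
    by rewrite openC; apply: closedI => //; exact: interval_closed.
  move=> O [x Ox] Oo; apply: contrapT => OU.
  have OC y : O y -> C i y /\ p' <= y <= q'.
    by move=> Oy; apply: contrapT => Cy; apply: OU; exists y; split=> //.
  have /nbhs_ballP[r /= r0 rO] := open_nbhs_nbhs (conj Oo Ox).
  apply: H; exists i, (Num.max p' (x - r)), (Num.min q' (x + r)).
  have [_ /andP[p'x xq']] := OC _ Ox.
  split.
  - by rewrite le_max ltW.
  - by rewrite gt_max !lt_min; do ! (apply/andP; split); lra.
  - by rewrite ge_min ltW.
  - move=> t; rewrite gt_max lt_min => /andP[? ?] /andP[? ?].
    by apply: (OC t _).1; apply: rO; rewrite /ball /= ltr_distlC; apply/andP; split; lra.
have oI : open `]p', q'[%classic by exact: interval_open.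
have [|t [/=]] := UD `]p', q'[%classic _ oI.
  by exists ((p' + q') / 2) => /=; rewrite in_itv /=; apply/andP; split; lra.
rewrite in_itv /= => /andP[p't tq'] tU.
have [||i Cit] := cov t; [lra|lra|].
by apply: (tU i I); split=> //=; rewrite in_itv /= !ltW.
Qed.

Definition open_rel (R : realType) (Q : R -> R -> Prop) : Prop :=
  forall x y, Q x y -> exists2 r : R, 0 < r &
    forall x' y', `|x' - x| < r -> `|y' - y| < r -> Q x' y'.

Section OpenTransitive.
Context (R : realType) (Q : R -> R -> Prop).
Hypothesis Qtr : forall x y z, Q x y -> Q y z -> Q x z.
Hypothesis Qop : open_rel Q.

(* The endpoint is the first w with ~ Q w y. *)
Lemma left_maximal x y : x < y -> Q x y -> ~ Q y y ->
  exists w, [/\ x < w, w <= y & forall z, x < z -> z < w -> ~ Q w z].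
Proof.
move=> xy Qxy Qyy.
have [w [xw wy wr Hw]] := @first_point _ (fun z => ~ Q z y) _ _ Qyy (ltW xy).
have Qwy : ~ Q w y.
  move=> /Qop[r r0 rQ]; have [|z [wz zr]] := wr (w + r); first by lra.
  by apply; apply: rQ; rewrite ?subrr ?normr0 // ger0_norm; lra.
exists w; split=> //.
  by rewrite lt_neqAle xw andbT; apply/eqP => E; apply: Qwy; rewrite -E.
move=> z xz zw Qwz; apply: Qwy; apply: (Qtr Qwz).
by apply: contrapT; apply: Hw => //; exact: ltW.
Qed.

(** Comparability is only dense, so [z] and [x] are linked through points between them: some [y]
    satisfies [Q z y], openness keeps this for the points just after [y], and one of these, [y'],
    satisfies [Q y' x]. *)
Lemma increasing_of_antimono c d :
  (forall x u v, c < x -> x < d -> c <= u -> u < v -> v <= d ->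
    exists y, [/\ u < y, y < v & Q x y \/ Q y x]) ->
  (forall z x, c < z -> z < x -> x < d -> ~ Q x z) ->
  forall z x, c < z -> z < x -> x < d -> Q z x.
Proof.
move=> good anti z x cz zx xd.
have [|||||y [zy yx Qy]] := good z z x => //; [lra|lra|lra|].
have Qzy : Q z y by case: Qy => // /anti; case=> //; lra.
have [r r0 rQ] := Qop Qzy.
have [|||||y' [yy' y'x Qy']] := good x y (Num.min x (y + r)) => //; [lra|lra| | |].
- by rewrite lt_min yx; lra.
- by rewrite ge_min ltW.
move: y'x; rewrite lt_min => /andP[y'x y'r].
have Qzy' : Q z y'.
  by apply: rQ; rewrite ?subrr ?normr0 // ger0_norm; lra.
apply: (Qtr Qzy'); case: Qy' => // /anti; case=> //; lra.
Qed.

End OpenTransitive.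

(** * Monotonicity of a definable comparison relation *)

Section Comparison.
Context (R : realType) (L : language) (S : structure L R).
Hypothesis S_exp : expands_ordered_group S.
Hypothesis S_A : type_A S.
Context (Q : R -> R -> Prop) (a b : R).
Hypothesis ab : a < b.
Hypothesis dQ : dfn S (fun e => Q (e 0%N) (e 1%N)).
Hypothesis Qtr : forall x y z, Q x y -> Q y z -> Q x z.
Hypothesis Qop : open_rel Q.
Hypothesis Qirr : forall x, a < x -> x < b -> ~ Q x x.
Hypothesis Qdense : forall p q u v, a <= p -> p < q -> q <= b ->
  a <= u -> u < v -> v <= b ->
  exists x y, [/\ p < x < q, u < y < v & Q x y \/ Q y x].

Let E (r x : R) : Prop := (a < x /\ x < b) /\ exists u : R, a <= u /\ u + r <= b /\
  forall y, u < y -> y < u + r -> ~ (Q x y \/ Q y x).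

(** The cells are treated one after the other: [Qdense] gives a comparable pair for the next cell,
    and openness of [Q] keeps its second point comparable with all points of a smaller interval. *)
Lemma comparable_cells (r p q : R) (n : nat) : 0 < r -> a <= p -> p < q -> q <= b ->
  exists p' q', [/\ p <= p', p' < q', q' <= q &
    forall x (i : nat), p' < x -> x < q' -> (i < n)%N -> a + i.+1%:R * r <= b ->
      exists y, [/\ a + i%:R * r < y, y < a + i.+1%:R * r & Q x y \/ Q y x]].
Proof.
move=> r0 ap pq qb; elim: n => [|n [p' [q' [pp' pq' qq' H]]]]; first by exists p, q; split.
have [nb|nb] := leP (a + n.+1%:R * r) b; last first.
  exists p', q'; split=> // x i px xq; rewrite ltnS leq_eqVlt => /orP[/eqP ->|].
    by rewrite leNgt nb.
  exact: H.
have [||||||x [y [/andP[px xq] /andP[yn ny] Qxy]]] :=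
  @Qdense p' q' (a + n%:R * r) (a + n.+1%:R * r) => //; [lra|lra| | |].
- by rewrite lerDl mulr_ge0 // ltW.
- by rewrite ltrD2l ltr_pM2r // ltr_nat.
have [s s0 sQ] : exists2 s : R, 0 < s & forall x', `|x' - x| < s -> Q x' y \/ Q y x'.
  by case: Qxy => /Qop[s s0 sQ]; exists s => // x' xx'; [left|right]; apply: sQ;
    rewrite // subrr normr0.
exists (Num.max p' (x - s)), (Num.min q' (x + s)); split.
- by rewrite le_max pp'.
- by rewrite gt_max !lt_min; do ! (apply/andP; split); lra.
- by rewrite ge_min qq'.
- move=> x' i; rewrite gt_max lt_min => /andP[px' x'x] /andP[x'q xx'].
  rewrite ltnS leq_eqVlt => /orP[/eqP -> _|]; last exact: H.
  by exists y; split=> //; apply: sQ; rewrite ltr_distl; apply/andP; split; lra.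
Qed.

Lemma nowhere_dense_incomparable (r : R) : 0 < r -> nowhere_dense (E r).
Proof.
move=> r0; apply: contrapT => /not_nowhere_dense[p [q [pq ED]]].
have [x [px xq [[ax xb] _]]] := ED p q (lexx _) pq (lexx _).
(* Cells have length [r / 2], so that every interval []u, u + r[] contains a whole one, namely the
   cell of index [i] below; [n] exceeds all these indices. *)
pose n := (Num.truncn ((b - a) / (r / 2))).+2.
have r20 : 0 < r / 2 by lra.
have [|||p' [q' [pp' pq' qq' H]]] :=
  @comparable_cells (r / 2) (Num.max p a) (Num.min q b) n r20.
- by rewrite le_max lexx orbT.
- by rewrite gt_max !lt_min; do ! (apply/andP; split); lra.
- by rewrite ge_min lexx orbT.
move: pp' qq'; rewrite ge_max le_min => /andP[pp' ap'] /andP[qq' q'b].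
have [x' [px' x'q [_ [u [au [ub uQ]]]]]] := ED p' q' pp' pq' qq'.
pose i := (Num.truncn ((u - a) / (r / 2))).+1.
have /andP[i1 i2] : (Num.truncn ((u - a) / (r / 2)))%:R <= (u - a) / (r / 2) < i%:R.
  by apply: truncn_itv; rewrite divr_ge0 ?subr_ge0 // ltW.
rewrite ler_pdivlMr // in i1; rewrite ltr_pdivrMr // in i2.
have iE : i.+1%:R * (r / 2) = (Num.truncn ((u - a) / (r / 2)))%:R * (r / 2) + r.
  by rewrite -[i.+1%:R]natr1 -[i%:R]natr1; lra.
have [||y [iy yi Qy]] := H x' i px' x'q.
- rewrite /i /n !ltnS; apply: le_truncn; rewrite ler_pM2r ?invr_gt0 //; lra.
- by rewrite iE; lra.
by apply: (uQ y) Qy; [lra|rewrite iE in yi; lra].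
Qed.

(** If [Q] never points to the left on some interval, it is [<] there; if its opposite never does,
    it is [>]. Otherwise the points that are [Q]-related to nothing just left of them form a nowhere
    dense set, for [Q] and for its opposite, which contradicts [left_maximal]. *)
Lemma comparison_monotone : exists c d, [/\ a <= c, c < d, d <= b &
  (forall z x, c < z -> z < x -> x < d -> Q z x) \/
  (forall z x, c < z -> z < x -> x < d -> Q x z)].
Proof.
have dE : dfn S (fun e => E (e 0%N) (e 1%N)) by rewrite /E; dfn_tac.
(* First use of type A: each single point of []a', b'[] has densely many comparable points. *)
have [|a' [b' [aa' ab' bb' Ho]]] := @nowhere_dense_union _ _ _ S_exp S_A E dE _ nowhere_dense_incomparable a b ab.
  move=> s t x s0 st [xab [u [au [ub uQ]]]]; split=> //; exists u; split=> //.
  by split; [lra|move=> y uy yu; apply: uQ => //; lra].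
have good x u v : a' < x -> x < b' -> a' <= u -> u < v -> v <= b' ->
    exists y, [/\ u < y, y < v & Q x y \/ Q y x].
  move=> ax xb au uv vb; apply: contrapT => nQ; apply: (Ho x ax xb).
  exists (v - u); split; first lra.
  split; first by split; lra.
  exists u; split; first lra.
  split; first lra.
  by move=> y uy yv Qy; apply: nQ; exists y; split=> //; lra.
pose A (Q : R -> R -> Prop) r x := (a' < x /\ x < b') /\
  forall z, x - r < z -> z < x -> ~ Q x z.
have dA : dfn S (fun e => A Q (e 0%N) (e 1%N)) by rewrite /A; dfn_tac.
pose Qo x y := Q y x.
have dQo : dfn S (fun e => Qo (e 0%N) (e 1%N)) by rewrite /Qo; dfn_tac.
have dAo : dfn S (fun e => A Qo (e 0%N) (e 1%N)) by rewrite /A; dfn_tac.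
have Qotr x y z : Qo x y -> Qo y z -> Qo x z by move=> xy yz; exact: Qtr yz xy.
have Qoop : open_rel Qo.
  by move=> x y /Qop[r r0 rQ]; exists r => // x' y' xx yy; exact: rQ.
have Amono Q' s t x : 0 < s -> s <= t -> A Q' t x -> A Q' s x.
  by move=> s0 st [xab H]; split=> // z xz zx; apply: H => //; lra.
(* On an interval of length at most [r] where [A Q' r] is dense, [Q' x z] with [z < x] would persist
   when [x] moves to a nearby point of [A Q' r]. *)
have Adense Q' r : open_rel Q' -> 0 < r -> ~ nowhere_dense (A Q' r) -> exists c d,
    [/\ a' <= c, c < d, d <= b' & forall z x, c < z -> z < x -> x < d -> ~ Q' x z].
  move=> Q'op r0 /not_nowhere_dense[p [q [pq AD]]].
  have [x0 [px0 x0q [[ax0 x0b] _]]] := AD p q (lexx _) pq (lexx _).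
  exists (Num.max (Num.max p a') (x0 - r / 2)), (Num.min (Num.min q b') (x0 + r / 2)).
  split.
  - by rewrite !le_max lexx orbT.
  - by rewrite !gt_max !lt_min; do ! (apply/andP; split); lra.
  - by rewrite !ge_min lexx orbT.
  move=> z x; rewrite !gt_max !lt_min => /andP[/andP[? ?] ?] zx /andP[/andP[? ?] ?].
  move=> /Q'op[s s0 sQ].
  have [|||x' [x'1 x'x [_ Ax']]] := AD (Num.max z (x - s)) x.
  - by rewrite le_max; apply/orP; left; lra.
  - by rewrite gt_max zx /=; lra.
  - by lra.
  move: x'1; rewrite gt_max => /andP[zx' sx'].
  apply: (Ax' z) => //; first lra.
  by apply: sQ; rewrite ?subrr ?normr0 // ltr_distl; apply/andP; split; lra.
have [AQ|/existsNP[r /not_implyP[r0 /(Adense _ _ Qop r0)]]] :=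
  pselect (forall r, 0 < r -> nowhere_dense (A Q r)); last first.
  move=> [c [d [ac cd db anti]]]; exists c, d; split; [lra|lra|lra|left].
  apply: increasing_of_antimono => // x u v cx xd cu uv vd.
  by apply: good => //; lra.
have [AQo|/existsNP[r /not_implyP[r0 /(Adense _ _ Qoop r0)]]] :=
  pselect (forall r, 0 < r -> nowhere_dense (A Qo r)); last first.
  move=> [c [d [ac cd db anti]]]; exists c, d; split; [lra|lra|lra|right].
  apply: (@increasing_of_antimono _ Qo) => // x u v cx xd cu uv vd.
  have [|||||y [uy yv Qy]] := good x u v => //; [lra|lra|lra|lra|].
  by exists y; split=> //; case: Qy; [right|left].
exfalso.
have [u [v [au uv vb H1]]] := @nowhere_dense_union _ _ _ S_exp S_A _ dA (Amono Q) AQ a' b' ab'.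
have [u' [v' [uu' uv' vv' H2]]] :=
  @nowhere_dense_union _ _ _ S_exp S_A _ dAo (Amono Qo) AQo u v uv.
(* A comparable pair yields, by [left_maximal] for [Q] or its opposite, a point [w] of [A Q (w - x)]
   or [A Qo (w - x)], although []u', v'[] avoids all these sets. *)
have key x y : u' < x -> x < y -> y < v' -> Q x y \/ Q y x -> False.
  move=> ux xy yv [Qxy|Qyx].
    have [|w [xw wy wQ]] := left_maximal Qtr Qop xy Qxy; first by apply: Qirr; lra.
    apply: (H1 w); [lra|lra|exists (w - x); split; first lra].
    by split=> [|z zw wz]; [split; lra|apply: wQ => //; lra].
  have [|w [xw wy wQ]] := @left_maximal _ Qo Qotr Qoop _ _ xy Qyx; first by apply: Qirr; lra.
  apply: (H2 w); [lra|lra|exists (w - x); split; first lra].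
  by split=> [|z zw wz]; [split; lra|apply: wQ => //; lra].
have [||||||x [y [/andP[ux xv] /andP[uy yv] Qxy]]] := @Qdense u' v' u' v' => //; try lra.
case: (ltgtP x y) => xy.
- exact: (key x y).
- by apply: (key y x) => //; case: Qxy; [right|left].
- by move: Qxy; rewrite xy => -[]; apply: Qirr; lra.
Qed.

End Comparison.

(** * Generic higher convexity of definable continuous functions *)

Section MonotoneDifferences.
Context (R : realType) (L : language) (S : structure L R).
Hypothesis S_exp : expands_ordered_group S.

(** For fixed [m] the condition unfolds to [m] quantifiers over steps and one over points. *)
Lemma dfn_kconvex m (G : (nat -> R) -> R -> R) s t :
  dfun S (fun e => G (fun i => e i.+1) (e 0%N)) -> dfun S s -> dfun S t ->
  dfn S (fun e => kconvex m (G e) (s e) (t e)).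
Proof.
elim: m G s t => [|m IH] G s t dG ds dt /=.
  have ds' := dfun_rename succn ds; have dt' := dfun_rename succn dt.
  by dfn_tac.
refine (@dfn_all _ _ _ (fun h e => 0 < h ->
  kconvex m (fun x => G e (x + h) - G e x) (s e) (t e - h)) _); cbv beta.
apply: dfn_imp; first by dfn_tac.
apply: (IH (fun e x => G (fun i => e i.+1) (x + e 0%N) - G (fun i => e i.+1) x)).
- have dG' := dfun_rename (fun i => if i is j.+1 then j.+3 else 0%N) dG.
  by apply: dfun_sub2 => //;
    apply: (@dfun_sub _ _ _ (fun x e => G (fun i => e i.+2) x)) => //; dfn_tac.
- exact: dfun_rename.
- by apply: dfun_sub2 => //; [exact: dfun_rename|exact: dfun_var].
Qed.

Hypothesis S_A : type_A S.

Lemma kconvex_generic m (F : R -> R) (a b : R) :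
  dfun S (fun e => F (e 0%N)) -> continuous F -> a < b ->
  exists c d, [/\ a <= c, c < d, d <= b &
    kconvex m F c d \/ kconvex m (fun x => - F x) c d].
Proof.
elim: m F a b => [|m IH] F a b dF Fc ab.
  have [[x [ax xb Fx]]|H] := pselect (exists x, [/\ a < x, x < b & 0 < F x]).
    have /cvgrPdist_lt/(_ _ Fx)/nbhs_ballP[r /= r0 rF] := Fc x.
    exists (Num.max a (x - r / 2)), (Num.min b (x + r / 2)); split.
    - by rewrite le_max lexx.
    - by rewrite gt_max !lt_min; do ! (apply/andP; split); lra.
    - by rewrite ge_min lexx.
    - left=> y; rewrite ge_max le_min => /andP[? ?] /andP[? ?].
      have : `|F x - F y| < F x.
        by apply: rF; rewrite /ball /= ltr_distlC; apply/andP; split; lra.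
      by rewrite ltr_distlC subrr => /andP[/ltW].
  exists (a + (b - a) / 3), (b - (b - a) / 3); split; [lra|lra|lra|right].
  move=> x ax xb; rewrite oppr_ge0 leNgt; apply/negP => Fx.
  by apply: H; exists x; split=> //; lra.
apply: contrapT => H.
pose g t u := F (u + t) - F u.
pose Q x y := exists r : R, 0 < r /\ forall t : R, y - x - r < t -> t < y - x + r ->
  kconvex m (g t) (x - r) (x + r).
have dQ : dfn S (fun e => Q (e 0%N) (e 1%N)).
  rewrite /Q; dfn_tac.
  by apply: (@dfn_kconvex m (fun e u => F (u + e 0%N) - F u)); dfn_tac.
have Qtr x y z : Q x y -> Q y z -> Q x z.
  move=> [r [r0 rQ]] [s [s0 sQ]]; exists (Num.min r s); split; first by rewrite lt_min r0.
  move=> t t1 t2.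
  have [rs sr] : Num.min r s <= r /\ Num.min r s <= s by rewrite !ge_min !lexx orbT.
  (* The move from near [x] to near [z] is split at [u + (y - x)], which is near [y]. *)
  apply: (@kconvex_ext _ _ (fun u => g (t - (y - x)) (u + (y - x)) + g (y - x) u)).
    move=> u _ _; rewrite /g.
    have -> : u + (y - x) + (t - (y - x)) = u + t by lra.
    by lra.
  apply: kconvex_add.
    by apply: kconvex_shift; apply: (kconvex_sub _ _ (sQ (t - (y - x)) _ _)); lra.
  by apply: (kconvex_sub _ _ (rQ (y - x) _ _)); lra.
have Qop : open_rel Q.
  move=> x y [r [r0 rQ]]; exists (r / 3); first lra.
  move=> x' y'; rewrite !ltr_distl => /andP[? ?] /andP[? ?]; exists (r / 3).
  split; first lra.
  by move=> t t1 t2; apply: (kconvex_sub _ _ (rQ t _ _)); lra.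
have Qirr x : a < x -> x < b -> ~ Q x x.
  move=> ax xb [r [r0 rQ]]; apply: H.
  exists (Num.max a (x - r / 3)), (Num.min b (x + r / 3)); split.
  - by rewrite le_max lexx.
  - by rewrite gt_max !lt_min; do ! (apply/andP; split); lra.
  - by rewrite ge_min lexx.
  (* [Q x x] controls all steps [h < r]; the interval has length at most [2 * r / 3], so larger
     steps leave nothing to check. *)
  left=> h h0.
  have [xr xr'] : x - r / 3 <= Num.max a (x - r / 3) /\
      Num.min b (x + r / 3) <= x + r / 3 by rewrite le_max ge_min !lexx !orbT.
  have [hr|rh] := ltP h r; last by apply: kconvex_empty; lra.
  by apply: (kconvex_sub _ _ (rQ h _ _)); lra.
have gc x : continuous (fun t => g t x).
  move=> t; apply: cvgB; last exact: cvg_cst.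
  by apply: continuous_comp; [apply: cvgD; [exact: cvg_cst|exact: cvg_id]|exact: Fc].
have Qdense p q u v : a <= p -> p < q -> q <= b -> a <= u -> u < v -> v <= b ->
    exists x y, [/\ p < x < q, u < y < v & Q x y \/ Q y x].
  move=> ap pq qb au uv vb.
  (* If [x] is within [w] of [x0] and [t] within [w] of [t0], then [x + t] is within [2 * w] of the
     midpoint of []u, v[], hence inside. *)
  pose w := (v - u) / 4; pose x0 := (p + q) / 2; pose t0 := (u + v) / 2 - x0.
  pose p' := Num.max p (x0 - w); pose q' := Num.min q (x0 + w).
  have w0 : 0 < w by rewrite /w; lra.
  have [px0 x0q] : p < x0 /\ x0 < q by rewrite /x0; lra.
  have pq' : p' < q' by rewrite gt_max !lt_min; do ! (apply/andP; split); lra.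
  pose sg (s : bool) (y : R) := if s then y else - y.
  (* By induction each [g t] is [m]-convex up to sign on an interval, which may be taken rational.
     Baire then fixes the endpoints and the sign for a whole interval of [t]. *)
  pose C (n : nat) : set R := if unpickle n is Some (c, d, s) then
    (if [&& p' <= ratr c, (ratr c : R) < ratr d & ratr d <= q']
     then [set t | kconvex m (fun x => sg s (g t x)) (ratr c) (ratr d)] else set0) else set0.
  have Ccl n : closed (C n).
    rewrite /C; case: (unpickle n) => [[[c d] s]|]; last exact: closed0.
    case: ifP => _; last exact: closed0.
    apply: closed_kconvex => x t; case: s; first exact: gc.
    by apply: cvgN; exact: gc.
  have [|||n [t1 [t2 [wt1 t12 t2w nC]]]] := @baire_cover _ C (t0 - w) (t0 + w).
  - by lra.
  - exact: Ccl.
  - move=> t _ _.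
    have dg : dfun S (fun e => g t (e 0%N)) by rewrite /g; dfn_tac.
    have gtc : continuous (g t).
      move=> x; apply: cvgB; last exact: Fc.
      by apply: continuous_comp; [apply: cvgD; [exact: cvg_id|exact: cvg_cst]|exact: Fc].
    have [c [d [pc cd dq' Hcd]]] := IH _ _ _ dg gtc pq'.
    have [c' /[!in_itv]/= /andP[cc' c'd]] := rat_in_itvoo cd.
    have [d' /[!in_itv]/= /andP[cd' d'd]] := rat_in_itvoo c'd.
    have sub s : kconvex m (fun x => sg s (g t x)) c d -> exists i, C i t.
      move=> H'; exists (pickle (c', d', s)).
      rewrite /C pickleK cd' (le_trans pc (ltW cc')) (le_trans (ltW d'd) dq') /=.
      by apply: kconvex_sub H'; lra.
    by case: Hcd => Hcd; [exact: (sub true Hcd)|exact: (sub false Hcd)].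
  move: nC; rewrite /C; case: (unpickle n) => [[[c d] s]|]; last first.
    by move=> /(_ ((t1 + t2) / 2)) []; lra.
  case: ifP => [/and3P[pc cd dq]|_]; last first.
    by move=> /(_ ((t1 + t2) / 2)) []; lra.
  set c' : R := ratr c in pc cd *; set d' : R := ratr d in cd dq *; move=> nC.
  move: pc dq; rewrite ge_max le_min => /andP[pc xc] /andP[dq dx].
  pose x := (c' + d') / 2; pose t := (t1 + t2) / 2.
  pose r := Num.min ((d' - c') / 4) ((t2 - t1) / 4).
  have r0 : 0 < r by rewrite lt_min; apply/andP; split; lra.
  have [rd rt] : r <= (d' - c') / 4 /\ r <= (t2 - t1) / 4.
    by rewrite !ge_min !lexx orbT.
  exists x, (x + t); rewrite /x /t; split.
  - by apply/andP; split; lra.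
  - by move: xc dx wt1 t2w; rewrite /w /t0 => *; apply/andP; split; lra.
  case: s nC => nC; [left|right]; exists r; split=> // t'.
    move=> t't tt'; apply: (kconvex_sub _ _ (nC t' _ _)); lra.
  move=> t't tt'.
  (* For the negative sign the pair is reversed: a difference of step [t'] is minus a translated
     difference of step [- t']. *)
  apply: (@kconvex_ext _ _ (fun y => (fun z => - g (- t') z) (y + t'))).
    by move=> y _ _; rewrite /g /= addrK opprB.
  apply: (@kconvex_shift _ m (fun z => - g (- t') z)).
  by apply: (kconvex_sub _ _ (nC (- t') _ _)); lra.
have [c [d [ac cd db Qcd]]] := comparison_monotone S_exp S_A ab dQ Qtr Qop Qirr Qdense.
apply: H; exists (c + (d - c) / 3), (d - (d - c) / 3); split; [lra|lra|lra|].
case: Qcd => Qcd; [left|right] => h h0.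
  have [cdh|dch] := leP (c + (d - c) / 3) (d - (d - c) / 3 - h); last exact: kconvex_empty.
  (* [Q x (x + h)] gives [m]-convexity of the [h]-difference near each [x]; the middle third keeps
     [x] and [x + h] strictly inside []c, d[]. *)
  apply: kconvex_glue => // x cx xd.
  have [|||r [r0 rQ]] := Qcd x (x + h); [lra|lra|lra|].
  by exists r => //; apply: rQ; lra.
have [cdh|dch] := leP (c + (d - c) / 3) (d - (d - c) / 3 - h); last exact: kconvex_empty.
apply: kconvex_glue => // x cx xd.
have [|||r [r0 rQ]] := Qcd x (x + h); [lra|lra|lra|].
exists r => //; apply: (@kconvex_ext _ _ (fun u => (g (- h)) (u + h))).
  by move=> u _ _; rewrite /g addrK; lra.
by apply: kconvex_shift; apply: (kconvex_sub _ _ (rQ (- h) _ _)); lra.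
Qed.

Lemma kconvex_generic_le K (F : R -> R) (a b : R) :
  dfun S (fun e => F (e 0%N)) -> continuous F -> a < b ->
  exists c d, [/\ a <= c, c < d, d <= b & forall j, (j < K)%N ->
    kconvex j F c d \/ kconvex j (fun x => - F x) c d].
Proof.
move=> dF Fc ab; elim: K => [|K [c [d [ac cd db H]]]]; first by exists a, b; split.
have [c' [d' [cc cd' dd H']]] := kconvex_generic K dF Fc cd.
exists c', d'; split; [exact: le_trans cc|by []|exact: le_trans db|].
move=> j; rewrite ltnS leq_eqVlt => /orP[/eqP -> //|/H[] jP]; [left|right];
  exact: kconvex_sub jP.
Qed.

End MonotoneDifferences.

(** * From higher convexity to continuous derivatives *)

Section Smoothness.
Context (R : realType).
Implicit Types (f r : R -> R) (c d : R).

Definition continuous_oo f c d : Prop := forall x, c < x -> x < d -> {for x, continuous f}.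

(** Subtract the chord over [[x, y]] and let [p] maximize the difference [g]. If [g p > 0], midpoint
    convexity around [p], with the nearer endpoint as one of the two points, gives
    [2 * g p <= g p]. *)
Lemma chord_le f c d x z y : continuous_oo f c d -> kconvex 2 f c d ->
  c < x -> x < z -> z < y -> y < d ->
  (f z - f x) * (y - x) <= (f y - f x) * (z - x).
Proof.
move=> fc f2 cx xz zy yd.
pose l := (f y - f x) / (y - x).
pose g u := f u - f x - l * (u - x).
have gx : g x = 0 by rewrite /g !subrr mulr0 subrr.
have gy : g y = 0 by rewrite /g /l divfK ?subrr // gt_eqF; lra.
have [||p] := @EVT_max _ g x y _ _; first by lra.
  apply: continuous_in_subspaceT => u; rewrite inE /= in_itv /= => /andP[xu uy].
  apply: cvgB; first by apply: cvgB; [apply: fc; lra|exact: cvg_cst].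
  by apply: cvgM; [exact: cvg_cst|apply: cvgB; [exact: cvg_id|exact: cvg_cst]].
rewrite in_itv /= => /andP[xp py] pmax.
have gz : g z <= g p by apply: pmax; rewrite in_itv /=; lra.
suff gp : g p <= 0.
  have : g z <= 0 by exact: le_trans gp.
  rewrite /g /l => gz0.
  have : f z - f x <= (f y - f x) * (z - x) / (y - x) by lra.
  by rewrite ler_pdivlMr; lra.
rewrite leNgt; apply/negP => gp.
have xp' : x < p by rewrite lt_neqAle xp andbT; apply/eqP => E; rewrite -E gx ltxx in gp.
have py' : p < y by rewrite lt_neqAle py andbT; apply/eqP => E; rewrite E gy ltxx in gp.
have key h : 0 < h -> h <= p - x -> h <= y - p -> g p + g p <= g (p - h) + g (p + h).
  move=> h0 hx hy; have := f2 h h0 h h0 (p - h).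
  by rewrite subrK /g => /(_ _ _); move=> H; have := H ltac:(lra) ltac:(lra); lra.
have [le|lt] := leP (p - x) (y - p).
  have := key (p - x); rewrite subKr gx => /(_ _ _ _) H.
  have : g (p + (p - x)) <= g p by apply: pmax; rewrite in_itv /=; lra.
  by have := H ltac:(lra) ltac:(lra) ltac:(lra); lra.
have := key (y - p); rewrite subrKC gy => /(_ _ _ _) H.
have : g (p - (y - p)) <= g p by apply: pmax; rewrite in_itv /=; lra.
by have := H ltac:(lra) ltac:(lra) ltac:(lra); lra.
Qed.

Lemma right_derivative f c d : continuous_oo f c d -> kconvex 2 f c d ->
  exists r, (forall x, c < x -> x < d -> (f (x + h) - f x) / h @[h --> 0^'+] --> r x) /\
    (forall x h, c < x -> 0 < h -> x + h < d ->
       r x <= (f (x + h) - f x) / h /\ (f (x + h) - f x) / h <= r (x + h)).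
Proof.
move=> fc f2; pose q x h := (f (x + h) - f x) / h.
pose r x := inf (q x @` `]0, d - x[%classic).
have q_mono x h k : c < x -> 0 < h -> h <= k -> x + k < d -> q x h <= q x k.
  move=> cx h0; rewrite le_eqVlt => /orP[/eqP -> //|hk] kd; have k0 := lt_trans h0 hk.
  have := @chord_le f c d x (x + h) (x + k) fc f2; rewrite ![x + _ - x]addrC !addKr => H.
  rewrite /q ler_pdivrMr // mulrAC ler_pdivlMr //.
  by apply: H; lra.
have q_next x h k : c < x -> 0 < h -> 0 < k -> x + h + k < d -> q x h <= q (x + h) k.
  move=> cx h0 k0 kd.
  have := @chord_le f c d x (x + h) (x + h + k) fc f2.
  rewrite -[x + h + k]addrA ![x + _ - x]addrC !addKr => H.
  rewrite /q ler_pdivrMr // mulrAC ler_pdivlMr // -[x + h + k]addrA.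
  by have := H ltac:(lra) ltac:(lra) ltac:(lra) ltac:(lra); lra.
have q_lb x : c < x -> x < d -> has_lbound (q x @` `]0, d - x[%classic).
  move=> cx xd; pose y := (c + x) / 2; exists (q y (x - y)) => z [k /=].
  rewrite in_itv /= => /andP[k0 kd] <-.
  have := @q_next y (x - y) k; rewrite subrKC; apply; rewrite /y; lra.
exists r; split=> [x cx xd|x h cx h0 hd].
  apply: nondecreasing_at_right_cvgr; first by rewrite bnd_simp subr_gt0.
    move=> h k; rewrite !in_itv /= => /andP[h0 hd] /andP[k0 kd] hk.
    by apply: q_mono => //; lra.
  exact: q_lb.
split.
  by apply: ge_inf; [apply: q_lb; lra|exists h => //=; rewrite in_itv /=; lra].
apply: lb_le_inf.
  exists (q (x + h) ((d - (x + h)) / 2)), ((d - (x + h)) / 2) => //=.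
  by rewrite in_itv /=; lra.
move=> z [k /=]; rewrite in_itv /= => /andP[k0 kd] <-.
by apply: q_next => //; lra.
Qed.

(** One of the [m.+1] steps serves as the step of the difference quotient, and [m]-convexity passes
    to the pointwise limit. *)
Lemma kconvex_right_derivative m f r c d c' d' :
  (forall x, c < x -> x < d -> (f (x + h) - f x) / h @[h --> 0^'+] --> r x) ->
  c < c' -> d' < d -> kconvex m.+1 f c d -> kconvex m r c' d'.
Proof.
move=> fr cc dd fm.
apply: (@kconvex_cvg _ R 0^'+ _ m (fun h x => (f (x + h) - f x) / h)).
  by move=> x cx xd; apply: fr; lra.
near=> h.
have h0 : 0 < h by near: h; exact: nbhs_right_gt.
have hd : h < d - d' by near: h; apply: nbhs_right_lt; lra.
apply: (@kconvex_ext _ _ (fun x => h^-1 * (f (x + h) - f x))).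
  by move=> x _ _; rewrite mulrC.
apply: kconvex_scale; first by rewrite invr_ge0 ltW.
by apply: (kconvex_sub _ _ (fm h h0)); lra.
Unshelve. all: by end_near. Qed.

(** An increment over a step [t] is at most each of the next increments on its right if [r] is
    convex, on its left if [r] is concave. So [N] times it is bounded by the total increase
    [r d - r c]. *)
Lemma continuous_kconvex12 r c d : kconvex 1 r c d -> kconvex 2 r c d \/ kconvex 2 (fun x => - r x) c d ->
  continuous_oo r c d.
Proof.
move=> r1 r2.
have mono x y : c <= x -> x <= y -> y <= d -> r x <= r y.
  move=> cx; rewrite le_eqVlt => /orP[/eqP -> //|xy] yd.
  have := r1 (y - x) ltac:(lra) x; rewrite subrKC subr_ge0; apply; lra.
have step (N : nat) x t : 0 < t -> c <= x - N%:R * t -> x + N.+1%:R * t <= d ->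
    N%:R * (r (x + t) - r x) <= r d - r c.
  move=> t0 cN Nd.
  have inc u v h : 0 < h -> 0 < v -> c <= u -> u + v + h <= d ->
      kconvex 2 r c d -> r (u + h) - r u <= r (u + v + h) - r (u + v).
    move=> h0 v0 cu ud r2'; have := r2' h h0 v v0 u => H.
    by have := H ltac:(lra) ltac:(lra); lra.
  have dec u v h : 0 < h -> 0 < v -> c <= u -> u + v + h <= d ->
      kconvex 2 (fun x => - r x) c d -> r (u + v + h) - r (u + v) <= r (u + h) - r u.
    move=> h0 v0 cu ud r2'; have := r2' h h0 v v0 u => H.
    by have := H ltac:(lra) ltac:(lra); lra.
  have Nt0 (n : nat) : 0 <= n%:R * t by rewrite mulr_ge0 // ltW.
  have xd : x + t <= d.
    by have := Nt0 N; rewrite -natr1 mulrDl mul1r in Nd; lra.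
  case: r2 => r2.
    have sum (n : nat) : (n <= N)%N -> n%:R * (r (x + t) - r x) <= r (x + n%:R * t) - r x.
      elim: n => [|n IHn] nN; first by rewrite !mul0r addr0 subrr.
      have := IHn (ltnW nN); rewrite -!natr1 !mulrDl !mul1r [x + (_ + t)]addrA.
      case: n {IHn} nN => [|n] nN; first by rewrite !mul0r addr0; lra.
      have nN' : n.+2%:R * t <= N.+1%:R * t by rewrite ler_pM2r // ler_nat ltnW.
      have n0 : 0 < n.+1%:R * t by rewrite mulr_gt0.
      have := inc x (n.+1%:R * t) t t0 n0.
      rewrite -natr1 mulrDl mul1r in nN'.
      have := Nt0 N.
      by move=> ? H ?; have := H ltac:(lra) ltac:(lra) r2; lra.
    apply: le_trans (sum N (leqnn _)) _.
    have := Nt0 N; have : N%:R * t <= N.+1%:R * t by rewrite ler_pM2r // ler_nat.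
    move=> ? ?; have := mono (x + N%:R * t) d ltac:(lra) ltac:(lra) (lexx _).
    by have := mono c x (lexx _) ltac:(lra) ltac:(lra); lra.
  have sum (n : nat) : (n <= N)%N ->
      n%:R * (r (x + t) - r x) <= r (x + t) - r (x + t - n%:R * t).
    elim: n => [|n IHn] nN; first by rewrite !mul0r subr0 subrr.
    have := IHn (ltnW nN); rewrite -!natr1 !mulrDl !mul1r.
    case: n {IHn} nN => [|n] nN.
      by rewrite !mul0r !add0r subr0 addrK; lra.
    have nN' : n.+1%:R * t <= N%:R * t by rewrite ler_pM2r // ler_nat ltnW.
    have n0 : 0 < n.+1%:R * t by rewrite mulr_gt0.
    have := dec (x - n.+1%:R * t) (n.+1%:R * t) t t0 n0.
    rewrite subrK.
    rewrite (_ : x + t - (n.+1%:R * t + t) = x - n.+1%:R * t); last by lra.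
    rewrite (_ : x - n.+1%:R * t + t = x + t - n.+1%:R * t); last by lra.
    by move=> H ?; have := H ltac:(lra) ltac:(lra) r2; lra.
  apply: le_trans (sum N (leqnn _)) _.
  have := mono (x + t) d ltac:(have := Nt0 N; lra) xd (lexx _).
  by have := mono c (x + t - N%:R * t) (lexx _) ltac:(lra) ltac:(have := Nt0 N; lra); lra.
move=> x cx xd; apply/cvgrPdist_lt => /= e e0.
(* [N] forces increments below [e]; [s] leaves room for [N.+1] steps on either side of [x], one more
   than [N] because the base point may be [y] instead of [x]. *)
pose N := (Num.truncn ((r d - r c) / e)).+1.
have N0 : 0 < N%:R :> R by rewrite ltr0n.
have NB : r d - r c < N%:R * e by rewrite -ltr_pdivrMr //; exact: truncnS_gt.
pose s := Num.min (x - c) (d - x) / N.+1%:R.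
have m0 : 0 < Num.min (x - c) (d - x) by rewrite lt_min; apply/andP; split; lra.
have N10 : 0 < N.+1%:R :> R by rewrite ltr0n.
have s0 : 0 < s by rewrite divr_gt0.
have sN : N.+1%:R * s = Num.min (x - c) (d - x) by rewrite mulrC divfK // gt_eqF.
have [sc sd] : N.+1%:R * s <= x - c /\ N.+1%:R * s <= d - x.
  by rewrite sN !ge_min !lexx orbT.
have small t : 0 < t -> t < s -> N%:R * t + t <= N.+1%:R * s.
  by move=> t0 ts; rewrite -[X in _ + X]mul1r -mulrDl natr1 ler_pM2l // ltW.
have conc y t : 0 < t -> N%:R * (r (y + t) - r y) <= r d - r c -> r (y + t) - r y < e.
  by move=> t0 H; rewrite -(ltr_pM2l N0); exact: le_lt_trans NB.
apply/nbhs_ballP; exists s => //= y; rewrite /ball /= => xy.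
have xyr : c <= Num.min x y /\ Num.max x y <= d.
  have : s <= N.+1%:R * s by rewrite ler_peMl ?ler1n // ltW.
  move: xy; rewrite ltr_distlC => /andP[? ?] ?.
  by rewrite le_min ge_max; split; apply/andP; split; lra.
case: (ltgtP x y) => [lt|lt|->]; last by rewrite subrr normr0.
  have t0 : 0 < y - x by lra.
  have ts : y - x < s by rewrite ltr0_norm in xy; lra.
  have S := small _ t0 ts.
  have := conc x (y - x) t0; rewrite subrKC => C.
  have rxy : r x <= r y by apply: mono; move: xyr; rewrite le_min ge_max; lra.
  rewrite ler0_norm ?opprB; last lra.
  apply: C; have := @step N x (y - x) t0; rewrite subrKC; apply.
    by lra.
  by rewrite -natr1 mulrDl mul1r; lra.
have t0 : 0 < x - y by lra.
have ts : x - y < s by rewrite gtr0_norm in xy; lra.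
have S := small _ t0 ts.
have := conc y (x - y) t0; rewrite subrKC => C.
have rxy : r y <= r x by apply: mono; move: xyr; rewrite le_min ge_max; lra.
rewrite ger0_norm; last lra.
apply: C; have := @step N y (x - y) t0; rewrite subrKC; apply.
  by lra.
by rewrite -natr1 mulrDl mul1r; lra.
Qed.

(** Slopes between [x] and [x + h] lie between the values of [r] at these two points, for [h] of
    either sign, and [r] is continuous. *)
Lemma is_derive_right f r c d :
  (forall x h, c < x -> 0 < h -> x + h < d ->
     r x <= (f (x + h) - f x) / h /\ (f (x + h) - f x) / h <= r (x + h)) ->
  continuous_oo r c d -> forall x, c < x -> x < d -> is_derive x 1 f (r x).
Proof.
move=> fr rc x cx xd.
suff H : h^-1 *: ((f \o shift x) (h *: 1) - f x) @[h --> 0^'] --> r x.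
  apply: DeriveDef; first by apply/cvg_ex; exists (r x).
  exact: cvg_lim H.
apply/cvgrPdist_lt => e e0.
have /cvgrPdist_lt/(_ e e0)/nbhs_ballP[s /= s0 sr] := rc x cx xd.
near=> h.
have h0 : h != 0 by near: h; exact: nbhs_dnbhs_neq.
have hm : `|h| < Num.min s (Num.min (x - c) (d - x)).
  near: h; apply: dnbhs0_lt; rewrite !lt_min s0 /=; apply/andP; split; lra.
move: hm; rewrite !lt_min => /andP[hs /andP[hc hd]].
have rh : `|r x - r (x + h)| < e.
  by apply: sr; rewrite /ball /= opprD addNKr normrN.
rewrite /= /shift /= [h *: 1]mulr1 -[_ *: _]/(h^-1 * _) mulrC [h + x]addrC.
case: (ltgtP h 0) h0 => // h0 _.
  move: hc hd; rewrite ltr0_norm // => hc hd.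
  have := fr (x + h) (- h); rewrite addrK => H.
  have [H1 H2] := H ltac:(lra) ltac:(lra) ltac:(lra).
  rewrite invrN mulrN -mulNr opprB in H1 H2.
  rewrite ltr_distlC in rh; rewrite ltr_distlC.
  by move: rh => /andP[? ?]; apply/andP; split; lra.
rewrite gtr0_norm // in hd.
have [H1 H2] := fr x h cx h0 ltac:(lra).
rewrite ltr_distlC in rh; rewrite ltr_distlC.
by move: rh => /andP[? ?]; apply/andP; split; lra.
Unshelve. all: by end_near. Qed.

(** Order 2 makes the right derivative monotone and order 3 makes it convex or concave, hence
    continuous. The last two clauses hand the higher orders on to it. *)
Lemma differentiable_kconvex23 f c d : continuous_oo f c d -> kconvex 2 f c d ->
  kconvex 3 f c d \/ kconvex 3 (fun x => - f x) c d ->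
  exists r, [/\ (forall x, c < x -> x < d -> is_derive x 1 f (r x)),
    continuous_oo r c d,
    (forall m c' d', c < c' -> d' < d -> kconvex m.+1 f c d -> kconvex m r c' d') &
    (forall m c' d', c < c' -> d' < d -> kconvex m.+1 (fun x => - f x) c d ->
       kconvex m (fun x => - r x) c' d')].
Proof.
move=> fc f2 f3; have [r [fr rq]] := right_derivative fc f2.
have rp m c' d' : c < c' -> d' < d -> kconvex m.+1 f c d -> kconvex m r c' d'.
  by move=> cc dd; exact: kconvex_right_derivative.
have rn m c' d' : c < c' -> d' < d -> kconvex m.+1 (fun x => - f x) c d ->
    kconvex m (fun x => - r x) c' d'.
  move=> cc dd; apply: kconvex_right_derivative => // x cx xd.
  rewrite (_ : (fun h => _) = (fun h => - ((f (x + h) - f x) / h))).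
    by apply: cvgN; exact: fr.
  by apply/funext => h; rewrite -mulNr; congr (_ / _); lra.
have rc : continuous_oo r c d.
  move=> x cx xd; apply: (@continuous_kconvex12 _ ((c + x) / 2) ((d + x) / 2)); [| |lra|lra].
    by apply: rp f2; lra.
  by case: f3 => f3; [left; apply: rp f3|right; apply: rn f3]; lra.
by exists r; split=> //; exact: is_derive_right.
Qed.

(** Each derivative costs one order; the two extra orders in [k.+2] are those that
    [differentiable_kconvex23] needs for the last derivative. *)
Lemma smooth_kconvex k f c d : continuous_oo f c d ->
  (forall j, (1 < j)%N -> (j <= k.+2)%N -> kconvex j f c d \/ kconvex j (fun x => - f x) c d) ->
  forall x, c < x -> x < d ->
    (forall j, (j < k)%N -> derivable (derive1n j f) x 1) /\
    (forall j, (j <= k)%N -> {for x, continuous (derive1n j f)}).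
Proof.
elim: k f c d => [|k IH] f c d fc fP x cx xd.
  by split=> [//|[|//] _]; exact: fc.
have [r [fr rc rp rn]] : exists r, [/\ (forall x, c < x -> x < d -> is_derive x 1 f (r x)),
    continuous_oo r c d,
    (forall m c' d', c < c' -> d' < d -> kconvex m.+1 f c d -> kconvex m r c' d') &
    (forall m c' d', c < c' -> d' < d -> kconvex m.+1 (fun x => - f x) c d ->
       kconvex m (fun x => - r x) c' d')].
  have f3 := fP 3 isT isT.
  case: (fP 2 isT isT) => f2; first exact: differentiable_kconvex23.
  have [||r [fr rc rp rn]] := @differentiable_kconvex23 (fun x => - f x) c d _ f2.
  - by move=> y cy yd; apply: cvgN; exact: fc.
  - case: f3 => f3; [right|by left].
    by apply: kconvex_ext f3 => y _ _; rewrite opprK.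
  exists (fun x => - r x); split.
  - move=> y cy yd; have := is_deriveN (fr y cy yd).
    by rewrite (_ : - _ = f) //; apply/funext => z; rewrite /= opprK.
  - by move=> y cy yd; apply: cvgN; exact: rc.
  - move=> m c' d' cc dd fm; apply: rn => //.
    by apply: kconvex_ext fm => y _ _; rewrite opprK.
  - move=> m c' d' cc dd fm; apply: (@kconvex_ext _ _ r); first by move=> y _ _; rewrite opprK.
    exact: rp.
have f'E y : c < y -> y < d -> derive1 f y = r y.
  by move=> cy yd; rewrite derive1E; have := fr y cy yd => ?; rewrite derive_val.
have f'c : continuous_oo (derive1 f) c d.
  move=> y cy yd.
  have near_r : \forall z \near y, r z = derive1 f z.
    apply/nbhs_ballP; exists (Num.min (y - c) (d - y)) => /=.
      by rewrite lt_min; apply/andP; split; lra.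
    move=> z; rewrite /ball /= lt_min !ltr_distlC => /andP[/andP[? ?] /andP[? ?]].
    by rewrite f'E //; lra.
  apply: cvg_trans (near_eq_cvg near_r) _.
  by rewrite /= f'E //; exact: rc.
(* The induction hypothesis is used on a smaller interval around [x], because the derivative
   inherits convexity only strictly inside []c, d[]. *)
have [||D' C'] := IH (derive1 f) ((c + x) / 2) ((d + x) / 2) _ _ x ltac:(lra) ltac:(lra).
- by move=> y cy yd; apply: f'c; lra.
- move=> j j1 jk; have [] := fP j.+1 (ltnW j1) jk => fj; [left|right].
    apply: kconvex_ext (rp j ((c + x) / 2) ((d + x) / 2) _ _ fj); [|lra|lra].
    by move=> y cy yd; rewrite f'E //; lra.
  apply: kconvex_ext (rn j ((c + x) / 2) ((d + x) / 2) _ _ fj); [|lra|lra].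
  by move=> y cy yd; rewrite f'E //; lra.
split=> -[|j] jk.
- by have := fr x cx xd => ?; exact: ex_derive.
- by rewrite derive1Sn; exact: D'.
- exact: fc.
- by rewrite derive1Sn; exact: C'.
Qed.

End Smoothness.

(** * Definable families and the locus of higher convexity *)

Section Families.
Context (R : realType) (L : language) (S : structure L R).
Local Notation env := (nat -> R).

Lemma eq_dfun (s t : env -> R) : s =1 t -> dfun S s -> dfun S t.
Proof. by move=> /funext ->. Qed.

Definition dvec n (v : env -> 'rV[R]_n) : Prop := forall i, dfun S (fun e => v e ord0 i).

Lemma dvec_rename n (v : env -> 'rV[R]_n) r : dvec v -> dvec (fun e => v (fun i => e (r i))).
Proof. by move=> dv i; exact: (dfun_rename r (dv i)). Qed.

Lemma dvec_row_mx n m (u : env -> 'rV[R]_n) (v : env -> 'rV[R]_m) :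
  dvec u -> dvec v -> dvec (fun e => row_mx (u e) (v e)).
Proof.
move=> du dv i; case: (split_ordP i) => j ->.
- by rewrite (_ : (fun e => _) = (fun e => u e ord0 j)) //; apply/funext => e; rewrite row_mxEl.
- by rewrite (_ : (fun e => _) = (fun e => v e ord0 j)) //; apply/funext => e; rewrite row_mxEr.
Qed.

Lemma dfn_forall_nat K (P : nat -> env -> Prop) :
  (forall j, dfn S (P j)) -> dfn S (fun e => forall j, (j < K)%N -> P j e).
Proof.
move=> dP; elim: K => [|K IH].
  apply: (@eq_dfn _ _ _ (fun e => e 0%N = e 0%N)) => //.
  by apply: dfn_eq; exact: dfun_var.
apply: (@eq_dfn _ _ _ (fun e => P K e /\ forall j, (j < K)%N -> P j e)).
  move=> e; split=> [[PK H] j|H].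
    by rewrite ltnS leq_eqVlt => /orP[/eqP -> //|]; exact: H.
  by split=> [|j jK]; apply: H => //; exact: leqW.
exact: dfn_and.
Qed.

Hypothesis S_exp : expands_ordered_group S.

Lemma dfun_max s t : dfun S s -> dfun S t -> dfun S (fun e => Num.max (s e) (t e)).
Proof.
move=> ds dt; have ds' := dfun_rename succn ds; have dt' := dfun_rename succn dt.
apply: (@eq_dfn _ _ _ (fun e =>
  (s (fun i => e i.+1) <= t (fun i => e i.+1) /\ e 0%N = t (fun i => e i.+1)) \/
  (t (fun i => e i.+1) <= s (fun i => e i.+1) /\ e 0%N = s (fun i => e i.+1)))).
  move=> e; case: (leP (s _) (t _)) => st; split.
  - by move=> [[_ ->]//|[ts ->]]; apply/eqP; rewrite eq_le st ts.
  - by move=> ->; left.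
  - by move=> [[]|[_ ->]].
  - by move=> ->; right; split; rewrite ?(ltW st).
by dfn_tac.
Qed.

Lemma dfun_min s t : dfun S s -> dfun S t -> dfun S (fun e => Num.min (s e) (t e)).
Proof.
move=> ds dt; rewrite (_ : (fun e => _) = (fun e => - Num.max (- s e) (- t e))).
  by apply: dfun_opp => //; apply: dfun_max; exact: dfun_opp.
by apply/funext => e; rewrite oppr_max !opprK.
Qed.

Context (n : nat) (Z : set 'rV[R]_n) (I : 'rV[R]_n -> set R) (f : 'rV[R]_n -> R -> R).
Hypothesis I_def : definable_family S Z (fun z => vec_set (I z)).
Hypothesis f_def : definable_family S Z (fun z => graph_on (I z) (f z)).

(** Extension by 0, since [dfun] concerns total functions. *)
Definition total_part (z : 'rV[R]_n) (x : R) : R :=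
  if pselect (Z z /\ I z x) then f z x else 0.

Lemma total_partE z x : Z z -> I z x -> total_part z x = f z x.
Proof. by move=> Zz Ix; rewrite /total_part; case: pselect => // -[]. Qed.

Lemma dfn_dom v t : dvec v -> dfun S t -> dfn S (fun e => Z (v e) /\ I (v e) (t e)).
Proof.
move=> dv dt; pose w e : 'rV[R]_(n + 1) := row_mx (v e) (\row__ t e).
apply: eq_dfn (dfn_vec (v := w) I_def _).
  by move=> e; rewrite /vec_set /= row_mxKl row_mxKr mxE.
apply: dvec_row_mx => // i.
by rewrite (_ : (fun e => _) = t) //; apply/funext => e; rewrite mxE.
Qed.

Lemma dfun_total_part v t : dvec v -> dfun S t -> dfun S (fun e => total_part (v e) (t e)).
Proof.
move=> dv dt; have dv' := dvec_rename succn dv; have dt' := dfun_rename succn dt.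
set v' := fun e => _ in dv'; set t' := fun e => _ in dt'.
pose w e : 'rV[R]_(n + 2) := row_mx (v' e) (\row_(i < 2) if i == ord0 then t' e else e 0%N).
have dw : dvec w.
  apply: dvec_row_mx => // i; case: (eqVneq i ord0) => i0.
    by rewrite (_ : (fun e => _) = t') //; apply/funext => e; rewrite mxE i0.
  rewrite (_ : (fun e => _) = (fun e => e 0%N)); first exact: dfun_var.
  by apply/funext => e; rewrite mxE (negbTE i0).
apply: (@eq_dfn _ _ _ (fun e =>
  (Z (v' e) /\ I (v' e) (t' e) /\ e 0%N = f (v' e) (t' e)) \/
  (~ (Z (v' e) /\ I (v' e) (t' e)) /\ e 0%N = 0))).
  move=> e; rewrite /total_part -/(v' e) -/(t' e); case: pselect => ZI; split.
  - by move=> [[_ []]|[]].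
  - by move=> ->; left; case: ZI.
  - by move=> [[Zv [Iv _]]|[_ ->]] //; exfalso; apply: ZI.
  - by move=> ->; right.
apply: dfn_or; last first.
  by apply: dfn_and; [apply: dfn_not; exact: dfn_dom|dfn_tac].
apply: eq_dfn (dfn_vec f_def dw) => e.
by rewrite /graph_on /= row_mxKl row_mxKr !mxE.
Qed.

(** A definable condition that, for [K = k.+3], makes the function [C^k] near [x] by
    [smooth_kconvex]; it serves as the set [U z]. *)
Definition kconvex_locus (K : nat) (z : 'rV[R]_n) (x : R) : Prop :=
  (Z z /\ I z x) /\ exists r : R, 0 < r /\
    (forall y, x - r <= y -> y <= x + r -> Z z /\ I z y) /\
    forall j, (j < K)%N -> kconvex j (total_part z) (x - r) (x + r) \/
      kconvex j (fun y => - total_part z y) (x - r) (x + r).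

Lemma dfn_kconvex_locus K v t : dvec v -> dfun S t -> dfn S (fun e => kconvex_locus K (v e) (t e)).
Proof.
move=> dv dt; apply: dfn_and; first exact: dfn_dom.
refine (@dfn_ex _ _ _ (fun r e => 0 < r /\
    (forall y, t e - r <= y -> y <= t e + r -> Z (v e) /\ I (v e) y) /\
    forall j, (j < K)%N -> kconvex j (total_part (v e)) (t e - r) (t e + r) \/
      kconvex j (fun y => - total_part (v e) y) (t e - r) (t e + r)) _); cbv beta.
have dv1 := dvec_rename succn dv; have dt1 := dfun_rename succn dt.
have dv2 := dvec_rename succn dv1; have dt2 := dfun_rename succn dt1.
apply: dfn_and; first by dfn_tac.
apply: dfn_and.
  refine (@dfn_all _ _ _ (fun y e => t (fun i => e i.+1) - e 0%N <= y ->
    y <= t (fun i => e i.+1) + e 0%N ->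
    Z (v (fun i => e i.+1)) /\ I (v (fun i => e i.+1)) y) _); cbv beta.
  apply: dfn_imp; first by dfn_tac.
  apply: dfn_imp; first by dfn_tac.
  by apply: dfn_dom => //; exact: dfun_var.
apply: dfn_forall_nat => j; apply: dfn_or.
  apply: (@dfn_kconvex _ _ _ S_exp j (fun e => total_part (v (fun i => e i.+1)))); [|by dfn_tac..].
  by apply: dfun_total_part => //; exact: dfun_var.
apply: (@dfn_kconvex _ _ _ S_exp j (fun e y => - total_part (v (fun i => e i.+1)) y)); [|by dfn_tac..].
by apply: dfun_opp => //; apply: dfun_total_part => //; exact: dfun_var.
Qed.

End Families.

(** * Generic smoothness in definable families *)

Theorem theorem3p8 (R : realType) (L : language) (S : structure L R)
  (S_exp : expands_ordered_group S) (S_A : type_A S) (k n : nat)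
  (Z : set 'rV[R]_n) (Z_def : definable S Z)
  (I : 'rV[R]_n -> set R)
  (I_def : definable_family S Z (fun z => vec_set (I z)))
  (I_itv : forall z, Z z -> bounded_open_interval (I z))
  (f : 'rV[R]_n -> R -> R)
  (f_def : definable_family S Z (fun z => graph_on (I z) (f z)))
  (f_cont : forall z, Z z -> {within I z, continuous (f z)}) :
  exists U : 'rV[R]_n -> set R,
    definable_family S Z (fun z => vec_set (U z)) /\
    forall z, Z z ->
      [/\ open (U z), U z `<=` I z, dense_in (U z) (I z) & Ck_on k (f z) (U z)].
Proof.
(* The bound on orders is strict: [j < k.+3] covers everything up to [k.+2]. *)
pose U z x := kconvex_locus Z I f k.+3 z x.
have f_at z x : Z z -> I z x -> {for x, continuous (f z)}.
  move=> Zz Ix; have [Io _ _] := I_itv z Zz; have := f_cont z Zz.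
  by rewrite continuous_open_subspace // => H; apply: H; rewrite inE.
exists U; split.
  apply: dfn_definable.
  have dv : dvec S (fun e => lsubmx (\row_(i < n + 1) e i)).
    move=> i; apply: (@eq_dfun _ _ _ (fun e => e i)); last exact: dfun_var.
    by move=> e; rewrite !mxE.
  apply: dfn_and; first exact: (dfn_vec Z_def dv).
  apply: (dfn_kconvex_locus S_exp I_def f_def k.+3 dv).
  apply: (@eq_dfun _ _ _ (fun e => e n)); last exact: dfun_var.
  by move=> e; rewrite !mxE /= addn0.
move=> z Zz; have [Io Iitv Ibd] := I_itv z Zz; split.
- rewrite openE => x [[_ Ix] [r [r0 [rI rP]]]]; apply/nbhs_ballP; exists (r / 2).
    by rewrite /=; lra.
  move=> y; rewrite /ball /= ltr_distlC => /andP[yx xy].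
  split; first by apply: rI; lra.
  exists (r / 2); split; first lra.
  split; first by move=> w yw wy; apply: rI; lra.
  by move=> j /rP[]; [left|right]; apply: kconvex_sub; (try eassumption); lra.
- by move=> x [[]].
- move=> x Ix B /= Bx.
  have /nbhs_ballP[p /= p0 pBI] : nbhs x (B `&` I z).
    by apply: filterI => //; exact: open_nbhs_nbhs.
  have pBI' y : x - p < y -> y < x + p -> B y /\ I z y.
    by move=> xy yx; apply: pBI; rewrite /ball /= ltr_distlC; apply/andP; split; lra.
  pose a := x - p / 2; pose b := x + p / 2.
  (* Clamping to [[a, b]], which lies in [I z], makes [F] definable and continuous on the whole line
     while it agrees with [f z] on [[a, b]]. *)
  pose cl (u : R) : R := Num.max a (Num.min u b).
  have ab : a < b by rewrite /a /b; lra.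
  have cl_ab u : a <= cl u /\ cl u <= b.
    by rewrite /cl le_max lexx ge_max ge_min lexx orbT (ltW ab).
  have cl_id u : a <= u -> u <= b -> cl u = u.
    by move=> au ub; rewrite /cl (min_idPl ub) (max_idPr au).
  have cl_I u : I z (cl u).
    by have := cl_ab u; rewrite /a /b => -[? ?]; apply: (pBI' _ _ _).2; lra.
  pose F (u : R) : R := total_part Z I f z (cl u).
  have dF : dfun S (fun e => F (e 0%N)).
    have dcl : dfun S (fun e => cl (e 0%N)).
      apply: dfun_max => //; first exact: dfun_cst.
      by apply: dfun_min => //; [exact: dfun_var|exact: dfun_cst].
    refine (dfun_total_part I_def f_def (v := fun=> z) _ dcl).
    by move=> i; exact: dfun_cst.
  have Fc : continuous F.
    rewrite (_ : F = f z \o cl); last by apply/funext => u; rewrite /F total_partE.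
    move=> u; apply: continuous_comp; last exact: f_at.
    apply: continuous_max; first exact: cst_continuous.
    by apply: continuous_min; [exact: cvg_id|exact: cst_continuous].
  have [c [d [ac cd db H]]] := kconvex_generic_le S_exp S_A k.+3 dF Fc ab.
  rewrite /a /b in ac db.
  pose y := (c + d) / 2.
  have [By Iy] : B y /\ I z y by apply: pBI'; rewrite /y; lra.
  exists y; split=> //; split=> //; split=> //.
  exists ((d - c) / 2); split; first lra.
  have -> : y - (d - c) / 2 = c by rewrite /y; lra.
  have -> : y + (d - c) / 2 = d by rewrite /y; lra.
  split; first by move=> w cw wd; split=> //; apply: (pBI' _ _ _).2; lra.
  move=> j /H[]; [left|right]; apply: kconvex_ext; try eassumption.
    by move=> w cw wd; rewrite /F cl_id // /a /b; lra.
  by move=> w cw wd; rewrite /F cl_id // /a /b; lra.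
- have main x : U z x -> (forall j, (j < k)%N -> derivable (derive1n j (f z)) x 1) /\
      (forall j, (j <= k)%N -> {for x, continuous (derive1n j (f z))}).
    move=> [_ [r [r0 [rI rP]]]].
    apply: (@smooth_kconvex _ k (f z) (x - r) (x + r)); [| |lra|lra].
      by move=> y xy yx; apply: f_at => //; apply: (rI _ _ _).2; exact: ltW.
    move=> j _ jk; have [] := rP j jk => jP; [left|right]; apply: kconvex_ext jP => y xy yx.
      by rewrite total_partE //; exact: (rI _ _ _).2.
    by rewrite total_partE //; exact: (rI _ _ _).2.
  split=> [j x jk Ux|j jk]; first exact: (main x Ux).1.
  apply: continuous_in_subspaceT => x; rewrite inE => Ux.
  exact: (main x Ux).2.
Qed.
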